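(* Let $A$ be a quasi-hereditary CNakayama algebra with $n$ simple modules. Then $A$ has global dimension equal to $n$ if and only if it has Kupisch series $[2,2,\dots,2,3]$ (up to cyclic shift). Otherwise, $\operatorname{gldim}(A) \leq n-1$.
   Context: All algebras are finite dimensional quiver algebras $KQ/I$ over a field $K$ ($I$ an admissible ideal), connected and non-semisimple; modules are finitely generated right modules. A CNakayama algebra with $n$ simple modules is such an algebra $A$ whose quiver is the oriented cycle $0\to1\to\dots\to n-1\to 0$. Its Kupisch series is $[c_0,\dots,c_{n-1}]$ with $c_i=\dim_K e_iA$, where $e_iA$ is the uniserial indecomposable projective module with composition factors, from the top, $S_i,S_{i+1},S_{i+2},\dots$ (indices modulo $n$). The Kupisch series is defined only up to cyclic shift and determines the algebra up to isomorphism. *)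

(* Defs.v *)
From HB Require Import structures.
From mathcomp Require Import all_boot all_order all_algebra falgebra.
From mathcomp Require Import finmap.
From mathcomp.multinomials Require Import monalg.

Set Implicit Arguments.
Unset Strict Implicit.
Unset Printing Implicit Defensive.

Import GRing.Theory.

Local Open Scope ring_scope.

Record quiver := Quiver {
  vertex : finType;
  arrow : finType;
  asource : arrow -> vertex;
  atarget : arrow -> vertex;
  quiver_nonempty : (0 < #|vertex|)%N
}.

Section Paths.
Variable Q : quiver.

Fixpoint walk (v : vertex Q) (s : seq (arrow Q)) : bool :=
  if s is a :: s' then (asource a == v) && walk (atarget a) s' else true.

(* A path is a starting vertex followed by a composable list of arrows; the
   starting vertex is needed to tell apart the trivial paths. *)
Record qpath := QPath {
  qpath_val :> vertex Q * seq (arrow Q);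
  qpathP : walk qpath_val.1 qpath_val.2
}.

HB.instance Definition _ := [isSub for qpath_val].
HB.instance Definition _ := [Choice of qpath by <:].

Definition psource (p : qpath) : vertex Q := (val p).1.
Definition parrows (p : qpath) : seq (arrow Q) := (val p).2.
Definition ptarget (p : qpath) : vertex Q :=
  last (psource p) [seq atarget a | a <- parrows p].
Definition plength (p : qpath) : nat := size (parrows p).

Definition ptrivial (v : vertex Q) : qpath :=
  @QPath (v, [::]) isT.

Lemma walk_cat v s1 s2 :
  walk v (s1 ++ s2) = walk v s1 && walk (last v [seq atarget a | a <- s1]) s2.
Proof. by elim: s1 v => [|a s1 IHs] v //=; rewrite IHs andbA. Qed.

Lemma pcat_subproof (p q : qpath) : ptarget p == psource q ->
  walk (psource p) (parrows p ++ parrows q).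
Proof.
move=> /eqP e; rewrite walk_cat (qpathP p) -/(ptarget p) e; exact: (qpathP q).
Qed.

(* First p, then q. *)
Definition pcat (p q : qpath) (e : ptarget p == psource q) : qpath :=
  @QPath (psource p, parrows p ++ parrows q) (pcat_subproof e).

Lemma ptarget_pcat p q e : ptarget (@pcat p q e) = ptarget q.
Proof.
by rewrite /ptarget /= map_cat last_cat -/(ptarget p) (eqP e).
Qed.

End Paths.

Definition path_algebra (K : fieldType) (Q : quiver) := {malg K[qpath Q]}.

HB.instance Definition _ (K : fieldType) (Q : quiver) :=
  GRing.Lmodule.on (path_algebra K Q).

(* kq_path and kq_mul are locked because unification otherwise unfolds them. *)
HB.lock Definition kq_path (K : fieldType) (Q : quiver) (p : qpath Q)
  : path_algebra K Q := << p >>.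
Arguments kq_path K {Q} p.

Definition path_mul (K : fieldType) (Q : quiver) (p q : qpath Q)
    : path_algebra K Q :=
  if @idP (ptarget p == psource q) is ReflectT e then kq_path K (pcat e) else 0.

HB.lock Definition kq_mul (K : fieldType) (Q : quiver) (g h : path_algebra K Q)
    : path_algebra K Q :=
  \sum_(p <- msupp g) \sum_(q <- msupp h) (g@_p * h@_q) *: path_mul K p q.
Arguments kq_mul {K Q} g h.

Section PathAlgebra.
Variables (K : fieldType) (Q : quiver).

Local Notation KQ := (path_algebra K Q).
Local Notation kq_path := (@kq_path K Q).
Local Notation path_mul := (@path_mul K Q).
Local Notation kq_mul := (@kq_mul K Q).

Implicit Types (p q r : qpath Q) (g h : KQ).

Lemma mcoeff_path p q : (kq_path p)@_q = (p == q)%:R.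
Proof. by rewrite kq_path.unlock mcoeffU. Qed.

Lemma msupp_path p : (msupp (kq_path p) `<=` [fset p])%fset.
Proof. by rewrite kq_path.unlock msuppU_le. Qed.

Definition kq_one : KQ := \sum_(v : vertex Q) kq_path (ptrivial v).

Lemma path_mulT p q (e : ptarget p == psource q) :
  path_mul p q = kq_path (pcat e).
Proof.
rewrite /path_mul; case: {-}_ / idP => [e'|//].
by rewrite (bool_irrelevance e' e).
Qed.

Lemma path_mulF p q : ptarget p != psource q -> path_mul p q = 0.
Proof. by move=> /negP ne; rewrite /path_mul; case: {-}_ / idP. Qed.

Lemma kq_mulw (d1 d2 : {fset qpath Q}) g h :
  (msupp g `<=` d1)%fset -> (msupp h `<=` d2)%fset ->
  kq_mul g h = \sum_(p <- d1) \sum_(q <- d2) (g@_p * h@_q) *: path_mul p q.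
Proof.
move=> le1 le2; rewrite kq_mul.unlock (big_fset_incl _ le1) /=; last first.
  move=> p _ /mcoeff_outdom gp.
  by rewrite big1 // => q _; rewrite gp mul0r scale0r.
apply: eq_bigr => p _; apply/big_fset_incl => // q _ /mcoeff_outdom ->.
by rewrite mulr0 scale0r.
Qed.

Lemma kq_mulDl : left_distributive kq_mul +%R.
Proof.
move=> g1 g2 h.
have s1 := fsubsetUl (msupp g1) (msupp g2).
have s2 := fsubsetUr (msupp g1) (msupp g2).
have sh := fsubset_refl (msupp h).
rewrite (kq_mulw (msuppD_le g1 g2) sh) (kq_mulw s1 sh) (kq_mulw s2 sh).
rewrite -big_split; apply: eq_bigr => p _ /=.
rewrite -big_split; apply: eq_bigr => q _ /=.
by rewrite mcoeffD mulrDl scalerDl.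
Qed.

Lemma kq_mulDr : right_distributive kq_mul +%R.
Proof.
move=> h g1 g2.
have s1 := fsubsetUl (msupp g1) (msupp g2).
have s2 := fsubsetUr (msupp g1) (msupp g2).
have sh := fsubset_refl (msupp h).
rewrite (kq_mulw sh (msuppD_le g1 g2)) (kq_mulw sh s1) (kq_mulw sh s2).
rewrite -big_split; apply: eq_bigr => p _ /=.
rewrite -big_split; apply: eq_bigr => q _ /=.
by rewrite mcoeffD mulrDr scalerDl.
Qed.

Lemma kq_mulZl a g h : kq_mul (a *: g) h = a *: kq_mul g h.
Proof.
rewrite (kq_mulw (msuppZ_le a g) (fsubset_refl _)) kq_mul.unlock scaler_sumr.
apply: eq_bigr => p _; rewrite scaler_sumr; apply: eq_bigr => q _.
by rewrite mcoeffZ scalerA mulrA.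
Qed.

Lemma kq_mulZr a g h : kq_mul g (a *: h) = a *: kq_mul g h.
Proof.
rewrite (kq_mulw (fsubset_refl _) (msuppZ_le a h)) kq_mul.unlock scaler_sumr.
apply: eq_bigr => p _; rewrite scaler_sumr; apply: eq_bigr => q _.
by rewrite mcoeffZ scalerA mulrCA mulrA.
Qed.

Lemma kq_mul0 h : kq_mul 0 h = 0.
Proof. by rewrite kq_mul.unlock msupp0 big_seq_fset0. Qed.

Lemma kq_mulr0 h : kq_mul h 0 = 0.
Proof. by rewrite kq_mul.unlock big1 // => p _; rewrite msupp0 big_seq_fset0. Qed.

Lemma kq_mulUU p q : kq_mul (kq_path p) (kq_path q) = path_mul p q.
Proof.
rewrite (kq_mulw (d1 := [fset p]%fset) (d2 := [fset q]%fset)) ?msupp_path //.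
by rewrite !big_seq_fset1 !mcoeff_path !eqxx mulr1 scale1r.
Qed.

Lemma kqUE p (a : K) : (<< a *g p >> : KQ) = a *: kq_path p.
Proof.
by apply/malgP => q; rewrite mcoeffU mcoeffZ mcoeff_path mulr_natr.
Qed.

Lemma kqE g : g = \sum_(p <- msupp g) g@_p *: kq_path p.
Proof. by rewrite [LHS]monalgE; apply: eq_bigr => p _; exact: kqUE. Qed.

Lemma kq_mul_suml I (s : seq I) (F : I -> KQ) h :
  kq_mul (\sum_(i <- s) F i) h = \sum_(i <- s) kq_mul (F i) h.
Proof.
exact: (big_morph (kq_mul^~ h) (fun _ _ => kq_mulDl _ _ _) (kq_mul0 h)).
Qed.

Lemma kq_mul_sumr I (s : seq I) (F : I -> KQ) h :
  kq_mul h (\sum_(i <- s) F i) = \sum_(i <- s) kq_mul h (F i).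
Proof.
exact: (big_morph (kq_mul h) (fun _ _ => kq_mulDr _ _ _) (kq_mulr0 h)).
Qed.

Lemma path_mulA p q r :
  kq_mul (kq_path p) (path_mul q r) = kq_mul (path_mul p q) (kq_path r).
Proof.
have [epq|npq] := boolP (ptarget p == psource q); last first.
  rewrite (path_mulF npq) kq_mul0.
  have [eqr|nqr] := boolP (ptarget q == psource r); last first.
    by rewrite (path_mulF nqr) kq_mulr0.
  by rewrite (path_mulT eqr) kq_mulUU path_mulF.
rewrite (path_mulT epq); rewrite (kq_mulUU (pcat epq) r).
have [eqr|nqr] := boolP (ptarget q == psource r); last first.
  by rewrite (path_mulF nqr) kq_mulr0 path_mulF // ptarget_pcat.
rewrite (path_mulT eqr) kq_mulUU.
have e1 : ptarget p == psource (pcat eqr) by [].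
have e2 : ptarget (pcat epq) == psource r by rewrite ptarget_pcat.
rewrite (path_mulT e1) (path_mulT e2); congr (kq_path _).
by apply: val_inj; rewrite /= catA.
Qed.

Lemma kq_linear_ext (F G : KQ -> KQ) :
  linear F -> linear G -> (forall p, F (kq_path p) = G (kq_path p)) -> F =1 G.
Proof.
move=> linF linG eqFG g.
have F0 (H : KQ -> KQ) : linear H -> H 0 = 0.
  move=> linH; have := linH (-1) 0 0.
  by rewrite scaler0 addr0 => {1}->; rewrite scaleN1r addNr.
rewrite (kqE g); elim: (enum_fset (msupp g)) => [|p s IHs].
  by rewrite big_nil (F0 F) // (F0 G).
by rewrite big_cons linF linG eqFG IHs.
Qed.

Lemma kq_mul_linearl h : linear (kq_mul^~ h).
Proof. by move=> a x y /=; rewrite kq_mulDl kq_mulZl. Qed.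

Lemma kq_mul_linearr g : linear (kq_mul g).
Proof. by move=> a x y; rewrite kq_mulDr kq_mulZr. Qed.

Lemma kq_mulA : associative kq_mul.
Proof.
move=> g1 g2 g3.
apply: (kq_linear_ext (F := fun g => kq_mul g (kq_mul g2 g3))
  (G := fun g => kq_mul (kq_mul g g2) g3)) => [a x y|a x y|p] /=.
- exact: kq_mul_linearl.
- by rewrite (kq_mul_linearl g2) (kq_mul_linearl g3).
apply: (kq_linear_ext (F := fun g => kq_mul (kq_path p) (kq_mul g g3))
  (G := fun g => kq_mul (kq_mul (kq_path p) g) g3)) => [a x y|a x y|q] /=.
- by rewrite (kq_mul_linearl g3) kq_mul_linearr.
- by rewrite (kq_mul_linearr (kq_path p)) (kq_mul_linearl g3).
apply: (kq_linear_ext (F := fun g => kq_mul (kq_path p) (kq_mul (kq_path q) g))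
  (G := kq_mul (kq_mul (kq_path p) (kq_path q)))) => [a x y|a x y|r] /=.
- by rewrite (kq_mul_linearr (kq_path q)) kq_mul_linearr.
- exact: kq_mul_linearr.
by rewrite (kq_mulUU q r) (kq_mulUU p q) path_mulA.
Qed.

Lemma kq_mul1g : left_id kq_one kq_mul.
Proof.
move=> g; rewrite {1}(kqE g) [RHS]kqE kq_mul_sumr; apply: eq_bigr => p _.
rewrite kq_mulZr; congr (_ *: _).
rewrite /kq_one kq_mul_suml (bigD1_seq (psource p)) ?mem_index_enum //=;
  last exact: index_enum_uniq.
rewrite [X in _ + X]big1 => [|v /negbTE nv].
  have e : ptarget (ptrivial (psource p)) == psource p by [].
  rewrite addr0 kq_mulUU (path_mulT e); congr (kq_path _).
  by apply: val_inj; exact/esym/surjective_pairing.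
by rewrite kq_mulUU path_mulF // /ptarget /= nv.
Qed.

Lemma kq_mulg1 : right_id kq_one kq_mul.
Proof.
move=> g; rewrite {1}(kqE g) [RHS]kqE kq_mul_suml; apply: eq_bigr => p _.
rewrite kq_mulZl; congr (_ *: _).
rewrite /kq_one kq_mul_sumr (bigD1_seq (ptarget p)) ?mem_index_enum //=;
  last exact: index_enum_uniq.
rewrite [X in _ + X]big1 => [|v nv].
  have e : ptarget p == psource (ptrivial (ptarget p)) by [].
  rewrite addr0 kq_mulUU (path_mulT e); congr (kq_path _).
  apply: val_inj; rewrite /= cats0; exact/esym/surjective_pairing.
by rewrite kq_mulUU path_mulF // eq_sym.
Qed.

Lemma kq_one_neq0 : kq_one != 0.
Proof.
have /card_gt0P[v _] := quiver_nonempty Q.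
apply/eqP => /malgP/(_ (ptrivial v)); rewrite mcoeff0 /kq_one raddf_sum /=.
rewrite (bigD1 v) //= mcoeff_path eqxx big1 => [|w nw].
  by rewrite addr0 => /eqP; rewrite oner_eq0.
rewrite mcoeff_path; case: eqP => // - /(congr1 (@psource Q)) e.
by move: nw; rewrite -[w]/(psource (ptrivial w)) e eqxx.
Qed.

HB.instance Definition _ := GRing.Zmodule_isNzRing.Build KQ
  kq_mulA kq_mul1g kq_mulg1 kq_mulDl kq_mulDr kq_one_neq0.

Lemma kq_scalerAl (a : K) g h : a *: (g * h) = (a *: g) * h.
Proof. by rewrite -[RHS]/(kq_mul _ _) kq_mulZl. Qed.

Lemma kq_scalerAr (a : K) g h : a *: (g * h) = g * (a *: h).
Proof. by rewrite -[RHS]/(kq_mul _ _) kq_mulZr. Qed.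

HB.instance Definition _ := GRing.Lmodule_isLalgebra.Build K KQ kq_scalerAl.
HB.instance Definition _ := GRing.Lalgebra_isAlgebra.Build K KQ kq_scalerAr.

End PathAlgebra.

Definition two_sided_ideal (R : nzRingType) (I : R -> Prop) : Prop :=
  [/\ I 0, forall x y, I x -> I y -> I (x + y)
    & forall a x, I x -> I (a * x) /\ I (x * a)].

(* The m-th power of the arrow ideal of KQ: it has the paths of length at
   least m as a K-basis. *)
Definition arrow_ideal_pow (K : fieldType) (Q : quiver) (m : nat)
    (x : path_algebra K Q) : Prop :=
  forall p : qpath Q, p \in msupp x -> (m <= plength p)%N.

Definition admissible (K : fieldType) (Q : quiver)
    (I : path_algebra K Q -> Prop) : Prop :=
  [/\ two_sided_ideal I,
      exists2 m, (2 <= m)%N & forall x, arrow_ideal_pow m x -> I x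
    & forall x, I x -> arrow_ideal_pow 2 x].

(* phi exhibits A as KQ / I with I = ker phi admissible. *)
Definition admissible_presentation (K : fieldType) (Q : quiver)
    (A : falgType K) (phi : {lrmorphism path_algebra K Q -> A}) : Prop :=
  (forall a : A, exists x, phi x = a) /\ admissible (fun x => phi x = 0).

(* e_v A, with e_v the image in A of the trivial path at v. *)
Definition vertex_projective (K : fieldType) (Q : quiver) (A : falgType K)
    (phi : {lrmorphism path_algebra K Q -> A}) (v : vertex Q) : {vspace A} :=
  (<[phi (kq_path K (ptrivial v))]> * {:A})%VS.

Lemma cyclic_quiver_subproof n : (0 < n)%N -> (0 < #|'I_n|)%N.
Proof. by rewrite card_ord. Qed.

Definition cyclic_quiver (n : nat) (n_gt0 : (0 < n)%N) : quiver :=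
  @Quiver 'I_n 'I_n id (@ordS n) (cyclic_quiver_subproof n_gt0).

Definition kupisch_series (K : fieldType) (n : nat) (n_gt0 : (0 < n)%N)
    (A : falgType K)
    (phi : {lrmorphism path_algebra K (cyclic_quiver n_gt0) -> A}) : seq nat :=
  [seq \dim (@vertex_projective K (cyclic_quiver n_gt0) A phi i)
     | i <- enum 'I_n].

Section Modules.
Variable R : nzRingType.

Definition fin_generated (M : lmodType R) : Prop :=
  exists (d : nat) (g : 'I_d -> M),
    forall x, exists c : 'I_d -> R, x = \sum_i c i *: g i.

Definition projective (P : lmodType R) : Prop :=
  forall (M N : lmodType R) (g : {linear M -> N}) (f : {linear P -> N}),
    (forall y, exists x, g x = y) ->
    exists h : {linear P -> M}, forall x, g (h x) = f x.

Definition proj_dim_le (M : lmodType R) (d : nat) : Prop :=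
  exists (P : nat -> lmodType R)
         (del : forall i, {linear P i.+1 -> P i})
         (eps : {linear P 0%N -> M}),
  [/\ forall i, fin_generated (P i) /\ projective (P i),
      forall y, exists x, eps x = y,
      forall x, eps x = 0 <-> exists y, del 0%N y = x,
      forall i x, del i x = 0 <-> exists y, del i.+1 y = x
    & forall i (x : P i), (d < i)%N -> x = 0].

End Modules.

(* Right A-modules are left modules over the converse ring A^c. *)
Definition gldim_le (A : nzRingType) (d : nat) : Prop :=
  forall M : lmodType A^c, fin_generated M -> proj_dim_le M d.

Definition gldim_eq (A : nzRingType) (d : nat) : Prop :=
  gldim_le A d /\ forall e, gldim_le A e -> (d <= e)%N.

Definition right_ideal (R : nzRingType) (I : R -> Prop) : Prop :=
  [/\ I 0, forall x y, I x -> I y -> I (x + y) & forall x a, I x -> I (x * a)].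

Definition maximal_right_ideal (R : nzRingType) (I : R -> Prop) : Prop :=
  [/\ right_ideal I, ~ I 1
    & forall J : R -> Prop, right_ideal J -> (forall x, I x -> J x) ->
        ~ J 1 -> forall x, J x -> I x].

Definition jacobson_radical (R : nzRingType) (x : R) : Prop :=
  forall I : R -> Prop, maximal_right_ideal I -> I x.

(* The second component says that J, as a submodule of the right regular
   module B, is projective. *)
Definition heredity_ideal (K : fieldType) (B : falgType K) (J : {vspace B})
    : Prop :=
  [/\ two_sided_ideal (fun x => x \in J),
      exists (P : lmodType B^c) (f : {linear P -> B^c^o}),
        [/\ projective P, injective f & forall x, x \in J <-> exists p, f p = x],
      (J * J)%VS = J
    & forall x r y, x \in J -> jacobson_radical r -> y \in J -> x * r * y = 0].

(* In step i, pi : A -> B is the projection onto B = A / J_i, and the image of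
   J_{i+1} is J_{i+1} / J_i. *)
Definition quasi_hereditary (K : fieldType) (A : falgType K) : Prop :=
  exists (m : nat) (J : nat -> {vspace A}),
  [/\ J 0%N = 0%VS, J m = fullv,
      forall i, (i <= m)%N -> two_sided_ideal (fun x => x \in J i)
    & forall i, (i < m)%N ->
      [/\ (J i <= J i.+1)%VS, J i <> J i.+1
        & exists (B : falgType K) (pi : {lrmorphism A -> B}),
          [/\ forall b, exists a, pi a = b,
              forall a, pi a = 0 <-> a \in J i
            & heredity_ideal (linfun pi @: J i.+1)%VS]]].

(* Main.v *)
(* A vertex t such that e_t lies in the first ideal J of a heredity chain
   satisfies c_t <= n because J rad(A) J = 0, and for every other k the
   uniserial module e_kA either ends before reaching t or ends where e_tA
   does, because e_kJ is projective. No other part of the chain is needed.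
   Writing f(x) = x + c_x, a submodule of an indecomposable projective is an
   interval [b, f(a)), and its minimal resolution is read off the sequence a,
   b, f(a), f(b), f(f(a)), ..., which stops as soon as two consecutive terms
   agree. By the condition at t the sequence stops once it leaves the block
   {t, ..., t+n}; within the block it increases strictly, so it stops after at
   most n steps, and needs n steps only if it visits every vertex, that is for
   the Kupisch series [2,...,2,3]. Submodules of free modules are filtered by
   such intervals, which bounds the global dimension. For [2,...,2,3] a non-
   projective (n-1)-st syzygy, detected by Schanuel's lemma, gives the lower
   bound. *)

Require Import Defs.
From HB Require Import structures.
From mathcomp Require Import all_boot all_order all_algebra falgebra.
From mathcomp Require Import generic_quotient ring_quotient.
From mathcomp Require Import finmap.
From mathcomp.multinomials Require Import monalg.
From mathcomp Require Import boolp.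
From mathcomp Require Import zify.

Set Implicit Arguments.
Unset Strict Implicit.
Unset Printing Implicit Defensive.

Import GRing.Theory.

(** * Combinatorics of the Kupisch series *)

Section Intervals.
Variables (n : nat) (c : nat -> nat).
Hypothesis c_per : forall x, c (x + n) = c x.
Hypothesis c_ge2 : forall x, 2 <= c x.
Hypothesis c_mono : forall x, c x <= (c x.+1).+1.

Let f x := x + c x.

(* The module with interval [b, f a) is the syzygy of the one with interval
   [a, b), so the sequence a, b, f a, f b, ... describes a minimal projective
   resolution, which stops when two consecutive terms coincide. *)
Fixpoint stops d a b : bool :=
  (b == f a) || (if d is d'.+1 then stops d' b (f a) else false).

Lemma stopsS d a b : stops d a b -> stops d.+1 a b.
Proof.
elim: d a b => [|d IHd] a b; first by rewrite /= orbF => ->.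
by move=> /= /orP[->//|/IHd /= ->]; rewrite orbT.
Qed.

Lemma leq_stops d d' a b : d <= d' -> stops d a b -> stops d' a b.
Proof.
by move=> /subnK <-; elim: (d' - d) => // k IH /IH; rewrite addSn;
  exact: stopsS.
Qed.

Lemma stops_shift d a b : stops d (a + n) (b + n) = stops d a b.
Proof.
have fn x : f (x + n) = f x + n by rewrite /f c_per addnAC.
by elim: d a b => [|d IHd] a b /=; rewrite fn eqn_add2r // IHd.
Qed.

(** The hypothesis [c_mono] amounts to [f x <= f x.+1]: the radical of a projective is a quotient of
    the next projective. *)
Lemma cover_end_mono x y : x <= y -> f x <= f y.
Proof.
move=> /subnK <-; elim: (y - x) => // k IH; apply: leq_trans IH _.
by rewrite /f addSn; have := c_mono (k + x); lia.
Qed.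

(** * Resolutions in the block from [t] to [t + n] *)

Section Heredity.
Variable t : nat.
Hypothesis ct_le : c t <= n.
Hypothesis f_block :
  forall k, t < k < t + n -> f k <= t + n \/ f k = f (t + n).

Let ft_le : f t <= t + n. Proof. by rewrite leq_add2l. Qed.

Let f_gt x : x.+2 <= f x. Proof. by have := c_ge2 x; rewrite /f; lia. Qed.

(** The start [t] is excluded because [c t <= n] keeps [f t] inside the block; elsewhere only the
    second case of [f_block] remains. *)
Let f_top k : t <= k < t + n -> t + n < f k -> t < k /\ f k = f (t + n).
Proof.
move=> /andP[tk kn] lt; have ltk : t < k.
  by rewrite ltn_neqAle tk andbT; apply/negP => /eqP e; rewrite -e in lt; lia.
by split=> //; case: (@f_block k); rewrite ?ltk //; lia.
Qed.

Let f_top2 a b : t <= a <= b -> a < b <= t + n -> t + n < f a -> f b = f a.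
Proof.
move=> tab abn lt; have [_ fa] := @f_top a ltac:(lia) lt.
have := @cover_end_mono a b ltac:(lia);
  have := @cover_end_mono b (t + n) ltac:(lia); lia.
Qed.

(** The first entry increases with each step, so [d] steps are enough once [d + a] reaches the end
    of the block. If [f a] leaves the block earlier, [f_top2] ends the sequence. *)
Lemma stops_block d a b :
  t <= a -> a < b <= t + n -> b <= f a -> t + n <= d + a -> stops d a b.
Proof.
elim: d a b => [|d IHd] a b ta abn bf dn; first by lia.
rewrite /=; apply/orP; have [->|bfa] := eqVneq b (f a); [by left|right].
have [fan|fan] := leqP (f a) (t + n).
  apply: IHd; try lia; exact/cover_end_mono/ltnW/(andP abn).1.
by apply: (@leq_stops 0) => //=; rewrite orbF (@f_top2 a b) //; lia.
Qed.

(** A budget one smaller than in [stops_block] can fail only if no vertex is skipped: every step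
    advances by one, which forces the value 2 of [c] along the way. *)
Lemma stops_block_pred d a b :
  t <= a -> a < b <= t + n -> b <= f a -> t + n <= d + a.+1 ->
  stops d a b \/ b = a.+1 /\ forall x, a <= x -> x.+2 <= t + n -> c x = 2.
Proof.
elim: d a b => [|d IHd] a b ta abn bf dn.
  by right; split=> [|x]; lia.
rewrite /=; have [->|bfa] := eqVneq b (f a); [by left|].
have [fan|fan] := leqP (f a) (t + n); last first.
  by left; apply: (@leq_stops 0) => //=; rewrite orbF (@f_top2 a b) //; lia.
have bfb : f a <= f b by apply/cover_end_mono; lia.
have [ba|ba] := leqP a.+2 b.
  by left; apply: stops_block; lia.
have ba1 : b = a.+1 by lia.
have [st|[fa2 c2]] := IHd b (f a) ltac:(lia) ltac:(lia) bfb ltac:(lia).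
  by left; rewrite st ?orbT.
right; split=> // x ax xn.
by have [->|xa] := eqVneq x a; [rewrite /f in fa2; lia|apply: c2; lia].
Qed.

Let n_ge2 : 2 <= n. Proof. exact: leq_trans (c_ge2 t) ct_le. Qed.

(** If [b] lies beyond [t + n], then [f a = f t + n]; after one step the pair is, up to a shift by
    [n], [(b - n, f t)], whose first entry exceeds [t] and so fits the remaining [n.-1] steps. *)
Lemma stops_all a b : t <= a < t + n -> a <= b <= f a -> stops n a b.
Proof.
move=> ta ab; have [eab|ltab] := eqVneq a b.
  (* The case [a = b] is the whole projective, which needs one step. *)
  by rewrite -eab; apply: (@leq_stops 1); rewrite /= ?eqxx ?orbT //; lia.
have [bn|bn] := leqP b (t + n); first by apply: stops_block; lia.
rewrite -(prednK (ltnW n_ge2)) /=; apply/orP; right.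
have [lta fa] := @f_top a ltac:(lia) ltac:(lia).
have eb : b = (b - n) + n by lia.
have efa : f a = f t + n by rewrite fa /f c_per; lia.
rewrite efa [b in stops _ b _]eb stops_shift.
have [e|ne] := eqVneq (b - n) (f t).
  by apply: (@leq_stops 1); rewrite /= ?e ?eqxx ?orbT //; lia.
have := @cover_end_mono t (b - n) ltac:(lia).
by move=> ?; apply: stops_block; lia.
Qed.

(** Whether [c] equals 2 on the block except at its last vertex is decided first; if not, each
    exceptional outcome of [stops_block_pred] that would cost a step is contradictory. *)
Lemma stops_all_pred :
  (forall a b, t <= a < t + n -> a <= b <= f a -> stops n.-1 a b) \/
  (forall x, t <= x -> x.+2 <= t + n -> c x = 2) /\ c (t + n).-1 = 3.
Proof.
have [/'forall_implyP c2|nc2] := boolP [forall x : 'I_(t + n), (t <= x) &&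
  (x.+2 <= t + n) ==> (c x == 2)].
  have c2' x : t <= x -> x.+2 <= t + n -> c x = 2.
    by move=> tx xn; have := c2 (Ordinal (ltnW xn));
      rewrite /= tx xn => /(_ isT)/eqP.
  right; split=> //.
  (* The projective at [t + n - 1] leaves the block, so it ends where the one at [t + n] does,
     namely at [t + n + 2]. *)
  have [_] := @f_top (t + n).-1 ltac:(lia) ltac:(have := f_gt (t + n).-1; lia).
  by rewrite /f c_per (c2' t) //; lia.
have special a : t <= a <= t.+1 -> c t = 2 ->
    ~ forall x, a <= x -> x.+2 <= t + n -> c x = 2.
  move=> ta ct2 c2; apply: (negP nc2); apply/'forall_implyP => x /andP[tx xn].
  apply/eqP; have [->//|xt] := eqVneq (x : nat) t; apply: c2 => //; lia.
left=> a b ta ab; have [eab|ltab] := eqVneq a b.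
  by rewrite -eab; apply: (@leq_stops 1); rewrite /= ?eqxx ?orbT //; lia.
have [bn|bn] := leqP b (t + n).
  have [//|[ba c2]] := @stops_block_pred n.-1 a b ltac:(lia) ltac:(lia)
    ltac:(lia) ltac:(lia).
  have [ea|nea] := eqVneq a t; last by apply: stops_block; lia.
  have ct2 : c t = 2 by apply: c2; lia.
  by case: (@special a) => //; lia.
have [lta fa] := @f_top a ltac:(lia) ltac:(lia).
have eb : b = (b - n) + n by lia.
have efa : f a = f t + n by rewrite fa /f c_per; lia.
have step : stops n.-2 (b - n) (f t) -> stops n.-1 a b.
  have -> : n.-1 = n.-2.+1 by lia.
  by move=> st /=; rewrite efa [b in stops _ b _]eb stops_shift st orbT.
have [e|ne] := eqVneq (b - n) (f t).
  have -> : n.-1 = n.-2.+1 by lia.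
  rewrite /= efa; have -> : b = f t + n by lia.
  by rewrite eqxx.
have ffb := @cover_end_mono t (b - n) ltac:(lia).
(* From [t.+2] on, [n.-2] steps suffice; only [b - n = t.+1] needs [stops_block_pred]. *)
have [bt|bt] := leqP t.+2 (b - n); first by apply: step; apply: stops_block;
  lia.
have [|[ft2 c2]] := @stops_block_pred n.-2 (b - n) (f t) ltac:(lia) ltac:(lia)
  ffb ltac:(lia).
  exact: step.
have ct2 : c t = 2 by rewrite /f in ft2; lia.
by case: (@special (b - n)) => //; lia.
Qed.

End Heredity.
End Intervals.

Local Open Scope ring_scope.

(** * Projective dimension *)

Section LinearMaps.
Variable R : nzRingType.

Section Build.
Variables (M N : lmodType R) (f : M -> N) (lin_f : linear f).

Definition linear_of : {linear M -> N} :=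
  HB.pack f (GRing.isLinear.Build R M N *:%R f lin_f).

End Build.

(** Membership is a proposition, as kernels, images and ideals are given by equations and
    existentials; [submod_pred] makes it Boolean classically, so that a subtype can be formed. *)
Record submodule (M : lmodType R) := Submodule {
  submem :> M -> Prop;
  submem_closed : submem 0 /\
    forall a x y, submem x -> submem y -> submem (a *: x + y)
}.

Section Submodule.
Variables (M : lmodType R) (S : submodule M).

Definition submod_pred : {pred M} := fun x => `[< S x >].

Lemma submod_predP x : reflect (S x) (x \in submod_pred).
Proof. exact: asboolP. Qed.

Lemma submod_pred_closed : subsemimod_closed submod_pred.
Proof.
have [S0 SD] := submem_closed S.
split=> [|a x /submod_predP Sx]; last first.
  by apply/submod_predP; rewrite -[_ *: _]addr0; apply: SD.
split=> [|x y /submod_predP Sx /submod_predP Sy]; first exact/submod_predP.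
by apply/submod_predP; rewrite -[x]scale1r; apply: SD.
Qed.

HB.instance Definition _ :=
  GRing.isSubmodClosed.Build R M submod_pred submod_pred_closed.

Definition submod := {x : M | x \in submod_pred}.
HB.instance Definition _ := SubType.on submod.
HB.instance Definition _ := Choice.on submod.
HB.instance Definition _ := [SubChoice_isSubLmodule of submod by <:].

Definition incl : {linear submod -> M} := val.

Lemma incl_inj : injective incl. Proof. exact: val_inj. Qed.

Lemma inclP (x : submod) : S (incl x).
Proof. exact/submod_predP/(valP x). Qed.

Lemma incl_surj x : S x -> exists y, incl y = x.
Proof. by move=> /submod_predP Sx; exists (Sub x Sx). Qed.

Section Corestriction.
Variables (N : lmodType R) (g : {linear N -> M}) (gS : forall x, S (g x)).

Let corestr_fun x : submod := Sub (g x) (introT (submod_predP _) (gS x)).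

Lemma corestr_linear : linear corestr_fun.
Proof. by move=> a x y; apply: val_inj; exact: (linearP g). Qed.

Definition corestr := linear_of corestr_linear.

Lemma corestrK x : incl (corestr x) = g x.
Proof. by []. Qed.
End Corestriction.

End Submodule.

End LinearMaps.

(** * Short exact sequences and finite projective resolutions *)

Section Homological.
Variable R : nzRingType.
Implicit Types M N P : lmodType R.

Definition surj (T U : Type) (g : T -> U) := forall y, exists x, g x = y.

Definition short_exact N P M (i : N -> P) (g : P -> M) :=
  [/\ injective i, surj g & forall x, g x = 0 <-> exists y, i y = x].

Lemma linear_inj M N (f : {linear M -> N}) :
  (forall x, f x = 0 -> x = 0) -> injective f.
Proof.
move=> f0 x y eq_f; apply/eqP; rewrite -subr_eq0; apply/eqP/f0.
by rewrite linearB /= eq_f subrr.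
Qed.

Lemma linear_inj0 M N (f : {linear M -> N}) x : injective f -> f x = 0 -> x = 0.
Proof. by move=> inj_f fx; apply: inj_f; rewrite linear0. Qed.

Lemma factor_inj M N P (u : {linear M -> P}) (i : {linear N -> P}) :
  injective i -> (forall x, exists y, i y = u x) ->
  exists v : {linear M -> N}, forall x, i (v x) = u x.
Proof.
move=> inj_i /choice[v iv].
have lin_v : linear v by move=> a x y; apply: inj_i;
  rewrite [RHS]linearP /= !iv linearP.
by exists (linear_of lin_v).
Qed.

Section Kernel.
Variables (M N : lmodType R) (g : {linear M -> N}).

Lemma kermod_closed : g 0 = 0 /\
  forall a x y, g x = 0 -> g y = 0 -> g (a *: x + y) = 0.
Proof.
by split=> [|a x y gx gy]; rewrite ?linear0 // linearP gx gy scaler0 addr0.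
Qed.

Definition kermod := Submodule kermod_closed.

Lemma ker_exact : surj g -> short_exact (@incl _ _ kermod) g.
Proof.
move=> gs; split=> // [|x]; first exact: incl_inj.
by split=> [/(incl_surj (S := kermod))|[y <-]] //; exact: (inclP y).
Qed.

Lemma immod_closed : (exists x, g x = 0) /\
  forall a y y', (exists x, g x = y) -> (exists x, g x = y') ->
    exists x, g x = a *: y + y'.
Proof.
split=> [|a _ _ [x <-] [x' <-]]; first by exists 0; rewrite linear0.
by exists (a *: x + x'); rewrite linearP.
Qed.

Definition immod := Submodule immod_closed.
End Kernel.

Lemma fin_generated_surj M N (g : {linear M -> N}) :
  surj g -> fin_generated M -> fin_generated N.
Proof.
move=> gs [d [e gen]]; exists d, (g \o e) => y.
have [x <-] := gs y; have [c ->] := gen x; exists c.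
by rewrite linear_sum; apply: eq_bigr => i _; rewrite linearZ.
Qed.

Lemma fin_generated_prod M N :
  fin_generated M -> fin_generated N -> fin_generated (M * N)%type.
Proof.
move=> [d1 [g1 gen1]] [d2 [g2 gen2]].
exists (d1 + d2)%N, (fun k => match split k with
  inl i => (g1 i, 0) | inr j => (0, g2 j) end) => -[x y].
have [c1 ->] := gen1 x; have [c2 ->] := gen2 y.
exists (fun k => match split k with inl i => c1 i | inr j => c2 j end).
have sl i : split (lshift d2 i) = inl i by exact: (unsplitK (inl i)).
have sr i : split (rshift d1 i) = inr i by exact: (unsplitK (inr i)).
rewrite big_split_ord /=; symmetry.
under eq_bigr do rewrite sl.
under [X in _ + X]eq_bigr do rewrite sr.
symmetry.
have E1 (F : 'I_d1 -> M) : (\sum_i F i, 0) = \sum_i (F i, 0) :> M * N.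
  by elim/big_rec2: _ => // i a b _ <-; congr pair; rewrite addr0.
have E2 (F : 'I_d2 -> N) : (0, \sum_i F i) = \sum_i (0, F i) :> M * N.
  by elim/big_rec2: _ => // i a b _ <-; congr pair; rewrite addr0.
transitivity ((\sum_i c1 i *: g1 i, 0) + (0, \sum_i c2 i *: g2 i) : M * N).
  by congr pair; rewrite ?addr0 ?add0r.
rewrite E1 E2; congr (_ + _); apply: eq_bigr => i _;
  by congr pair; rewrite scaler0.
Qed.

Lemma projective_retract P M (s : {linear M -> P}) (r : {linear P -> M}) :
  cancel s r -> projective P -> projective M.
Proof.
move=> sK prP X Y g f gs; have [h gh] := prP _ _ g (f \o r) gs.
by exists (h \o s) => x /=; rewrite gh /= sK.
Qed.

Section Pairs.
Variables M N P : lmodType R.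

Lemma pair_linear (f : {linear P -> M}) (g : {linear P -> N}) :
  linear (fun x => (f x, g x) : M * N).
Proof. by move=> a x y /=; rewrite !linearP. Qed.

Lemma fst_linear : linear (fst : M * N -> M). Proof. by []. Qed.

Lemma snd_linear : linear (snd : M * N -> N). Proof. by []. Qed.

Lemma copair_linear (f : {linear M -> P}) (g : {linear N -> P}) :
  linear (fun x : M * N => f x.1 + g x.2).
Proof.
by move=> a x y /=; rewrite !linearP scalerDr addrACA.
Qed.

End Pairs.

Definition lpair M N P f g := linear_of (@pair_linear M N P f g).
Definition lcopair M N P f g := linear_of (@copair_linear M N P f g).
Definition lfst M N := linear_of (@fst_linear M N).
Definition lsnd M N := linear_of (@snd_linear M N).
Definition lidm M : {linear M -> M} := idfun.
Definition lzero M N : {linear M -> N} := \0.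
Definition linl M N := lpair (lidm M) (lzero M N).
Definition linr M N := lpair (lzero N M) (lidm N).

Lemma projective_prod P M :
  projective P -> projective M -> projective (P * M)%type.
Proof.
move=> prP prM X Y g f gs.
have [h1 gh1] := prP _ _ g (f \o linl P M) gs.
have [h2 gh2] := prM _ _ g (f \o linr P M) gs.
exists (lcopair h1 h2) => -[x y] /=; rewrite linearD /= gh1 gh2 /=.
by rewrite -linearD; congr (f _); congr pair; rewrite /= ?addr0 ?add0r.
Qed.

Definition fgproj P := fin_generated P /\ projective P.

Lemma fgproj_prod P M : fgproj P -> fgproj M -> fgproj (P * M)%type.
Proof.
by move=> [? ?] [? ?]; split;
  [exact: fin_generated_prod|exact: projective_prod].
Qed.

Lemma fgproj0 M : (forall x : M, x = 0) -> fgproj M.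
Proof.
move=> M0; split; first by exists 0%N, (fun=> 0) => x; exists (fun=> 0);
  rewrite big_ord0.
move=> X Y g f gs; exists (lzero M X) => x /=.
by rewrite (M0 x) !linear0.
Qed.

(* [pdlt d M]: the projective dimension of [M] is less than [d], the zero
   module having projective dimension -1. *)
Fixpoint pdlt (d : nat) M : Prop :=
  if d is d'.+1 then
    exists P N (i : {linear N -> P}) (g : {linear P -> M}),
      [/\ fgproj P, short_exact i g & pdlt d' N]
  else forall x : M, x = 0.

Lemma pdlt_ker d M P (g : {linear P -> M}) :
  fgproj P -> surj g -> pdlt d (submod (kermod g)) -> pdlt d.+1 M.
Proof.
by move=> prP gs pd; exists P, _, (incl (kermod g)), g; split=> //;
  exact: ker_exact.
Qed.

(** The cover of [M] is lifted along [phi] to a cover of [M'] with the same kernel, so no inverse of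
    [phi] has to be built. *)
Lemma pdlt_iso d M M' (phi : {linear M' -> M}) :
  injective phi -> surj phi -> pdlt d M -> pdlt d M'.
Proof.
case: d => [|d] inj_phi phis /=.
  by move=> M0 x; apply: inj_phi; rewrite linear0.
move=> [P [N [i [g [prP [inj_i gs gE] pdN]]]]].
have [h gh] := prP.2 _ _ phi g phis.
exists P, N, i, h; split=> //; split=> // [y|x].
  by have [x gx] := gs (phi y); exists x; apply: inj_phi; rewrite gh.
apply: iff_trans (gE x); rewrite -gh; split=> [->|hx]; first exact: linear0.
by apply: inj_phi; rewrite hx linear0.
Qed.

Lemma pdltS d M : pdlt d M -> pdlt d.+1 M.
Proof.
elim: d M => [|d IHd] M.
  move=> M0; exists M, M, (lidm M), (lidm M); split=> //; first exact: fgproj0.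
  split=> // [y|x]; first by exists y.
  by split=> _; [exists x|exact: M0].
move=> [P [N [i [g [prP ex pdN]]]]]; exists P, N, i, g; split=> //.
exact: IHd.
Qed.

Lemma leq_pdlt d d' M : (d <= d')%N -> pdlt d M -> pdlt d' M.
Proof.
by move=> /subnK <-; elim: (d' - d)%N => // k IH /IH; rewrite addSn;
  exact: pdltS.
Qed.

Lemma pdlt1_proj M : pdlt 1 M -> fgproj M.
Proof.
move=> [P [N [i [g [[fgP prP] [inj_i gs gE] N0]]]]].
have inj_g : injective g.
  apply: linear_inj => x /gE[y <-]; by rewrite (N0 y) linear0.
split; first exact: fin_generated_surj fgP.
have [s gs'] := @factor_inj M P M (lidm M) g inj_g gs.
exact: (projective_retract (r := g) (s := s)).
Qed.

Lemma proj_pdlt1 M : fgproj M -> pdlt 1 M.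
Proof.
move=> prM; apply: (@pdlt_ker 0 M M (lidm M)) => //= [y|x]; first by exists y.
apply: (@incl_inj _ _ (kermod (lidm M))); rewrite linear0.
exact: (inclP x).
Qed.

(** The covers of the two ends combine to a cover [P1 * P2] of the middle, by means of a lift [h] of
    the right-hand cover through [g]. Its kernel is an extension of the two kernels, to which
    induction applies. *)
Lemma horseshoe d N' N N'' (i : {linear N' -> N}) (g : {linear N -> N''}) :
  short_exact i g -> pdlt d N' -> pdlt d N'' -> pdlt d N.
Proof.
elim: d N' N N'' i g => [|d IHd] N' N N'' i g [inj_i gs gE] /=.
  by move=> N'0 N''0 x; have [y <-] := (gE x).1 (N''0 _);
    rewrite (N'0 y) linear0.
move=> [P1 [K1 [i1 [g1 [prP1 [inj_i1 g1s g1E] pdK1]]]]].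
move=> [P2 [K2 [i2 [g2 [prP2 [inj_i2 g2s g2E] pdK2]]]]].
have [h gh] := prP2.2 _ _ g g2 gs.
have gi x : g (i x) = 0 by apply/gE; exists x.
pose G := lcopair (i \o g1) h.
have GE x y : G (x, y) = i (g1 x) + h y by [].
have Gs : surj G.
  move=> z; have [y gy] := g2s (g z).
  have /gE[w iw] : g (z - h y) = 0 by rewrite linearB /= gh gy subrr.
  have [x gx] := g1s w.
  by exists (x, y); rewrite GE gx iw subrK.
apply: (pdlt_ker (fgproj_prod prP1 prP2) Gs).
have lP (k : submod (kermod G)) : exists y, i2 y = (lsnd P1 P2 \o incl _) k.
  apply/g2E => /=; have := inclP k; rewrite /= -gh.
  move=> /(congr1 g); rewrite linear0 linearD /= gi add0r; exact.
have [v iv] := factor_inj inj_i2 lP.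
have uP (k : K1) : kermod G ((linl P1 P2 \o i1) k).
  rewrite /= (_ : g1 (i1 k) = 0); last by apply/g1E; exists k.
  by rewrite !linear0 addr0.
apply: (IHd _ _ _ (corestr uP) v _ pdK1 pdK2); split.
- move=> x y /(congr1 (@incl _ _ _)); rewrite !corestrK /=.
  by move=> [] /inj_i1.
- move=> k2.
  have [n' hn'] : exists n', i n' = h (i2 k2).
    by apply/gE; rewrite gh; apply/g2E; exists k2.
  have [x gx] := g1s (- n').
  have Gk : kermod G (x, i2 k2) by rewrite /= gx linearN hn' addNr.
  have [k kE] := incl_surj Gk.
  by exists k; apply: inj_i2; rewrite iv /= [sval k]kE.
move=> k; split=> [vk|[k1 <-]].
  have y0 : (incl _ k).2 = 0 by have := iv k; rewrite vk linear0.
  have [k1 kE] : exists k1, i1 k1 = (incl _ k).1.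
    apply/g1E/(linear_inj0 inj_i).
    have: i (g1 (incl _ k).1) + h (incl _ k).2 = 0 := inclP k.
    by rewrite y0 linear0 addr0.
  exists k1; apply: (@incl_inj _ _ (kermod G)).
  by rewrite corestrK [RHS]surjective_pairing y0 -kE.
by apply: inj_i2; rewrite linear0 iv.
Qed.

Lemma prod_exact M N : short_exact (linl M N) (lsnd M N).
Proof.
split=> [x y []|y|[x y]] //; first by exists (0, y).
by split=> /= [->|[z [_ <-]] //]; exists x.
Qed.

Lemma pdlt_prod d M N : pdlt d M -> pdlt d N -> pdlt d (M * N)%type.
Proof. exact: horseshoe (prod_exact M N). Qed.

(* Schanuel's lemma up to projective summands. *)
Lemma pdlt_syzygy d M N P P' (i : {linear N -> P}) (g : {linear P -> M}) :
  (0 < d)%N -> short_exact i g -> fgproj P -> fgproj P' ->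
  pdlt d.+1 (M * P')%type -> exists2 P'', fgproj P'' & pdlt d (N * P'')%type.
Proof.
move=> d_gt0 [inj_i gs gE] prP prP' [P0 [K [i0 [g0 [prP0 [inj_i0 g0s g0E]
  pdK]]]]].
exists P0 => //.
pose G := lpair (g \o lfst P P') (lsnd P P').
(* The kernel [E] of [D] is the pullback of the surjections [G] and [g0]. Its projection to [P * P']
   has kernel [K], which bounds its projective dimension; its projection to [P0] has kernel [N] and
   splits. *)
pose D : {linear ((P * P') * P0)%type -> (M * P')%type} :=
  lcopair (GRing.opp \o G) g0.
have DE u y : D (u, y) = - G u + g0 y by [].
have Gs : surj G.
  by move=> [m q]; have [x <-] := gs m; exists (x, q).
pose E := kermod D.
have EP (e : submod E) : G (incl _ e).1 = g0 (incl _ e).2.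
  apply/eqP; rewrite eq_sym -subr_eq0 addrC; apply/eqP; exact: (inclP e).
pose e1 : {linear submod E -> (P * P')%type} := lfst _ _ \o incl E.
have uP (k : K) : E ((linr (P * P')%type P0 \o i0) k).
  rewrite /= (_ : g0 (i0 k) = 0) ?addr0; last by apply/g0E; exists k.
  by rewrite -[RHS]oppr0; congr (- _); congr pair; rewrite linear0.
have pdE : pdlt d (submod E).
  apply: (@horseshoe _ _ _ _ (corestr uP) e1) => //; last first.
    (* The quotient [P * P'] of [E] is projective but possibly nonzero, whence the positivity of
       [d]. *)
    apply: leq_pdlt d_gt0 _; exact/proj_pdlt1/fgproj_prod.
  split.
  - by move=> x y /(congr1 (@incl _ _ _)); rewrite !corestrK /= => -[] /inj_i0.
  - move=> u; have [y gy] := g0s (G u).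
    have Ee : E (u, y) by rewrite /= -/(G u) -[X in - X + _]/(G u) gy addNr.
    by have [e Ee'] := incl_surj Ee; exists e; rewrite /e1 /= [sval e]Ee'.
  move=> e; split=> [e10|[k <-] //].
  have := EP e; rewrite -[(incl _ e).1]/(e1 e) e10 linear0 => /esym/g0E[k kE].
  exists k; apply: (@incl_inj _ _ E); rewrite corestrK /= kE.
  by rewrite -[sval e]/(incl E e) [RHS]surjective_pairing -[(incl _ e).1]/(e1
    e) e10.
have e2s : surj (lsnd (P * P')%type P0 \o incl E).
  move=> y; have [u gu] := Gs (g0 y).
  have Ee : E (u, y) by rewrite /= -[X in - X + _]/(G u) gu addNr.
  by have [e Ee'] := incl_surj Ee; exists e; rewrite /= [sval e]Ee'.
have [s sE] := prP0.2 _ _ (lsnd (P * P')%type P0 \o incl E) (lidm P0) e2s.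
have tP (n : N) : E ((linl (P * P')%type P0 \o linl P P' \o i) n).
  rewrite /= linear0 addr0 (_ : g (i n) = 0) ?oppr0 //.
  by apply/gE; exists n.
(* The splitting [s] identifies [E] with [N * P0]. *)
pose phi := lcopair (corestr tP) s.
have phiE n y : incl _ (phi (n, y)) = ((i n, 0), 0) + incl _ (s y).
  by rewrite -[phi _]/(corestr tP n + s y) linearD corestrK.
apply: (@pdlt_iso _ _ _ phi) => //.
  apply: linear_inj => -[n y] phi0.
  have := phiE n y; rewrite phi0 linear0 => eq0.
  have y0 : y = 0.
    have := congr1 snd eq0;
      rewrite /= add0r -[X in _ = X]/((lsnd _ _ \o incl E) (s y)).
    by rewrite sE /= => <-.
  have := congr1 (fun z => z.1.1) eq0.
  by rewrite y0 !linear0 addr0 => /esym/(linear_inj0 inj_i) ->.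
move=> e.
pose e' := e - s (incl _ e).2.
have e'2 : (incl _ e').2 = 0.
  have sE' : (incl E (s (incl E e).2)).2 = (incl E e).2 := sE _.
  by rewrite /e' linearB [LHS](congr1 (+%R _) (congr1 -%R sE')) subrr.
have G0 := EP e'; rewrite e'2 linear0 in G0.
have g1 : g (incl _ e').1.1 = 0 by have := congr1 fst G0.
have p0 : (incl _ e').1.2 = 0 by have := congr1 snd G0.
have [n nE] := (gE _).1 g1.
exists (n, (incl _ e).2); apply: (@incl_inj _ _ E); rewrite phiE nE.
rewrite -[e in RHS](subrK (s (incl _ e).2)) linearD; congr (_ + _).
rewrite -/e' [RHS]surjective_pairing e'2; congr pair.
by rewrite [RHS]surjective_pairing p0.
Qed.

(** Truncating a resolution gives one of the kernel of [eps]; the index moves by one because [pdlt]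
    is a strict bound. *)
Lemma proj_dim_le_pdlt d M : proj_dim_le M d -> pdlt d.+1 M.
Proof.
elim: d M => [|d IHd] M [P [del [eps [prP epss epsE delE P0]]]];
  apply: (pdlt_ker (prP 0%N) epss).
  move=> x; apply: (@incl_inj _ _ (kermod eps)); rewrite linear0.
  by have [y <-] := (epsE _).1 (inclP x); rewrite (P0 1%N y) ?linear0.
have dP (x : P 1%N) : kermod eps (del 0%N x) by apply/epsE; exists x.
apply: IHd; exists (fun k => P k.+1), (fun k => del k.+1), (corestr dP).
split=> [k|y|x|k x|k x ?]; [exact: prP| | |exact: delE|exact: P0].
  have [x dx] := (epsE _).1 (inclP y).
  by exists x; apply: (@incl_inj _ _ (kermod eps)); rewrite corestrK dx.
apply: iff_trans (delE _ _); split=> [c0|dx].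
  by rewrite -[LHS](corestrK dP) c0 linear0.
by apply: (@incl_inj _ _ (kermod eps)); rewrite corestrK dx linear0.
Qed.

Lemma pdlt_proj_dim_le d M : pdlt d.+1 M -> proj_dim_le M d.
Proof.
elim: d M => [|d IHd] M [P [N [i [g [prP [inj_i gs gE] pdN]]]]].
  (* As [N] is zero here, it can fill all positive degrees. *)
  pose P' k := if k is _.+1 then N else P.
  exists P', (fun k => match k return {linear P' k.+1 -> P' k} with
    0%N => i | _.+1 => lzero N N end), g.
  split=> //.
  - by case=> [|k] //; exact: fgproj0.
  - case=> [|k] x; split=> [|_].
    + by move=> _; exists 0; rewrite (pdN x).
    + by rewrite (pdN x) linear0.
    + by move=> _; exists 0; rewrite (pdN x).
    + by rewrite (pdN x).
  by case=> [|k] // x _; exact: pdN.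
have [Q [del [eps [prQ epss epsE delE Q0]]]] := IHd N pdN.
pose P' k := if k is k'.+1 then Q k' else P.
exists P', (fun k => match k return {linear P' k.+1 -> P' k} with
  0%N => i \o eps | k'.+1 => del k' end), g.
split=> // [[|k]|x|[|k] x|[|k] x] //; [exact: prQ| | |exact: delE|exact: Q0].
  apply: iff_trans (gE x) _; split=> [[y <-]|[y <-]]; last by exists (eps y).
  by have [z <-] := epss y; exists z.
apply: iff_trans (epsE x); split=> [/(linear_inj0 inj_i)//|e0].
by rewrite /= e0 linear0.
Qed.

End Homological.

(** * Quotient modules *)

Section QuotientModule.
Variables (R : nzRingType) (M : lmodType R) (S : submodule M).
Local Open Scope quotient_scope.

Definition quotmod := Quotient.quot (submod_pred S).
HB.instance Definition _ := GRing.Zmodule.on quotmod.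
HB.instance Definition _ := EqQuotient.on quotmod.

Definition quotmod_pi (x : M) : quotmod := \pi_(Quotient.quot (submod_pred S))
  x.

Lemma quotmod_piE x y : (quotmod_pi x = quotmod_pi y) <-> S (x - y).
Proof.
split=> [e|Sxy]; first by apply/submod_predP; rewrite Quotient.idealrBE;
  apply/eqP.
by apply/eqP; rewrite -[_ == _]Quotient.idealrBE; apply/submod_predP.
Qed.

Lemma quotmod_pi_surj : surj quotmod_pi.
Proof. by move=> y; exists (repr y); rewrite /quotmod_pi reprK. Qed.

Lemma quotmod_piD x y : quotmod_pi (x + y) = quotmod_pi x + quotmod_pi y.
Proof. exact: (Quotient.pi_add (submod_pred S)). Qed.

Definition quotmod_scale (a : R) (x : quotmod) : quotmod :=
  quotmod_pi (a *: repr x).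

Lemma quotmod_pi_scale a x : quotmod_pi (a *: x) = quotmod_scale a (quotmod_pi
  x).
Proof.
apply/quotmod_piE; rewrite -scalerBr -[_ *: _]addr0.
have [S0 SD] := submem_closed S; apply: SD => //; apply/quotmod_piE.
by rewrite /quotmod_pi reprK.
Qed.

Fact quotmod_scaleA a b v :
  quotmod_scale a (quotmod_scale b v) = quotmod_scale (a * b) v.
Proof.
by have [x <-] := quotmod_pi_surj v; rewrite -!quotmod_pi_scale scalerA.
Qed.

Fact quotmod_scale1 : left_id 1 quotmod_scale.
Proof.
by move=> v; have [x <-] := quotmod_pi_surj v;
  rewrite -!quotmod_pi_scale scale1r.
Qed.

Fact quotmod_scaleDr : right_distributive quotmod_scale +%R.
Proof.
move=> a u v; have [x <-] := quotmod_pi_surj u;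
  have [y <-] := quotmod_pi_surj v.
by rewrite -quotmod_piD -!quotmod_pi_scale scalerDr quotmod_piD.
Qed.

Fact quotmod_scaleDl v : {morph quotmod_scale^~ v : a b / a + b}.
Proof.
move=> a b; have [x <-] := quotmod_pi_surj v.
by rewrite -!quotmod_pi_scale scalerDl quotmod_piD.
Qed.

HB.instance Definition _ := GRing.Zmodule_isLmodule.Build R quotmod
  quotmod_scaleA quotmod_scale1 quotmod_scaleDr quotmod_scaleDl.

Lemma quotmod_pi_linear : linear quotmod_pi.
Proof. by move=> a x y; rewrite quotmod_piD quotmod_pi_scale. Qed.

Definition qproj := linear_of quotmod_pi_linear.

Lemma quotmod_exact : short_exact (incl S) qproj.
Proof.
split=> [||x]; [exact: incl_inj|exact: quotmod_pi_surj|].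
rewrite -(linear0 qproj); split=> [/quotmod_piE|[y <-]].
  by rewrite subr0 => /incl_surj.
by apply/quotmod_piE; rewrite subr0; exact: inclP.
Qed.

End QuotientModule.

(** * Filtrations of syzygies by submodules of principal ideals *)

Section Regular.
Variable R : nzRingType.

(** The common kernels of the first maps filter [N], with factors embedded in [U] by the next map;
    joint injectivity makes the filtration end at zero, and [horseshoe] assembles the bound. *)
Lemma pdlt_family d m (N U : lmodType R) (g : 'I_m -> {linear N -> U}) :
  (forall x, (forall i, g i x = 0) -> x = 0) ->
  (forall i (S : submodule U), (forall y, S y -> exists x, g i x = y) ->
     pdlt d (submod S)) ->
  pdlt d N.
Proof.
elim: m N g => [|m IHm] N g joint pdS.
  by apply: (leq_pdlt (leq0n d)) => x; apply: joint => -[].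
pose g' := corestr (S := immod (g ord0)) (fun x => ex_intro _ x erefl).
have g'E x : incl _ (g' x) = g ord0 x by [].
apply: (@horseshoe _ _ _ _ _ (incl (kermod (g ord0))) g').
- split=> [||x]; first exact: incl_inj.
  + move=> y; have [x gx] := inclP y.
    by exists x; apply: (@incl_inj _ _ (immod (g ord0))); rewrite g'E.
  split=> [g'x|[y <-]].
    by apply: (incl_surj (S := kermod (g ord0))); rewrite /= -g'E g'x linear0.
  apply: (@incl_inj _ _ (immod (g ord0))); rewrite g'E linear0.
  exact: (inclP y).
- apply: (IHm _ (fun i => g (lift ord0 i) \o incl _)) => [x gx|i S Sg].
    apply: (@incl_inj _ _ (kermod (g ord0))); rewrite linear0.
    apply: joint => i; case: (unliftP ord0 i) => [j ->|->]; first exact: gx.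
    exact: (inclP x).
  by apply: (pdS (lift ord0 i)) => y /Sg[x <-]; exists (incl _ x).
by apply: (pdS ord0) => y [x <-]; exists x.
Qed.

Lemma free_fgproj m : fgproj 'rV[R]_m.
Proof.
split; first by exists m, (delta_mx 0) => x; exists (x 0); exact: row_sum_delta.
move=> X Y g f gs.
have /choice[e eE] : forall i, exists x, g x = f (delta_mx 0 i) by move=> i;
  exact: gs.
have lin : linear (fun x : 'rV[R]_m => \sum_i x 0 i *: e i).
  move=> a x y; rewrite scaler_sumr -big_split; apply: eq_bigr => i _ /=.
  by rewrite !mxE scalerDl scalerA.
exists (linear_of lin) => x /=;
  rewrite linear_sum {2}(row_sum_delta x) linear_sum.
by apply: eq_bigr => i _; rewrite !linearZ /= eE.
Qed.

Lemma rmul_linear (e : R) : linear (fun x : R^o => x * e : R^o).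
Proof. by move=> a x y; rewrite mulrDl -scalerAl. Qed.

Definition rmul e := linear_of (rmul_linear e).

(** The first syzygy of [M] lies in a free module. It is filtered by coordinates, and each factor
    again by the right multiplications with the [e j], jointly injective since the [e j] sum to
    1. *)
Lemma fin_generated_pdlt d n (e : 'I_n -> R) : \sum_i e i = 1 ->
  (forall i (S : submodule R^o), (forall y, S y -> exists x, y = x * e i) ->
     pdlt d (submod S)) ->
  forall M : lmodType R, fin_generated M -> pdlt d.+1 M.
Proof.
move=> sum_e pdS M [m [b gen]].
have lin : linear (fun x : 'rV[R]_m => \sum_i x 0 i *: b i).
  move=> a x y; rewrite scaler_sumr -big_split; apply: eq_bigr => i _ /=.
  by rewrite !mxE scalerDl scalerA.
apply: (pdlt_ker (g := linear_of lin) (free_fgproj m)) => [y|].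
  have [c ->] := gen y; exists (\row_i c i) => /=.
  by apply: eq_bigr => i _; rewrite mxE.
have linc i : linear (fun x : 'rV[R]_m => x 0 i : R^o).
  by move=> a x y; rewrite !mxE.
apply: (pdlt_family (g := fun i => linear_of (linc i) \o incl _)) => [x x0|i S
  _].
  apply: (@incl_inj _ _ (kermod (linear_of lin))); rewrite linear0.
  by apply/rowP => i; rewrite [RHS]mxE; exact: x0.
apply: (pdlt_family (g := fun j => rmul (e j) \o incl S)) => [x xe|j T Tg].
  apply: (@incl_inj _ _ S); rewrite linear0 -[LHS]mulr1 -sum_e mulr_sumr.
  by apply: big1 => j _; exact: xe.
by apply: (pdS j) => y /Tg[x <-]; exists (incl _ x).
Qed.

Lemma lideal_closed (x : R) : (exists a, 0 = a * x) /\
  forall (b : R) (y z : R^o), (exists a, y = a * x) -> (exists a, z = a * x) ->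
    exists a, b *: y + z = a * x.
Proof.
split=> [|b _ _ [a ->] [a' ->]]; first by exists 0; rewrite mul0r.
by exists (b * a + a'); rewrite mulrDl -mulrA.
Qed.

Definition lideal x : submodule R^o := Submodule (lideal_closed x).

Lemma lideal_self x : lideal x x. Proof. by exists 1; rewrite mul1r. Qed.

(** Since [y * e = y] throughout this ideal, a map out of it is lifted by lifting the image of the
    generator. *)
Lemma lideal_fgproj e : e * e = e -> fgproj (submod (lideal e)).
Proof.
move=> ee; have eK y : lideal e y -> y * e = y.
  by move=> [a ->]; rewrite -mulrA ee.
have [g gE] := incl_surj (lideal_self e).
have gen (y : submod (lideal e)) : y = (incl (lideal e) y : R) *: g.
  by apply: (@incl_inj _ _ (lideal e)); rewrite linearZ /= [sval g]gE; symmetry;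
    exact: eK (inclP y).
split; first by exists 1%N, (fun=> g) => y; exists (fun=> incl (lideal e) y);
  rewrite big_ord1.
move=> X Y p f ps; have [x px] := ps (f g).
have lin : linear (fun y : submod (lideal e) => (incl (lideal e) y : R) *: x).
  by move=> a y z; rewrite linearP scalerDl scalerA.
by exists (linear_of lin) => y /=; rewrite linearZ px -linearZ [in RHS](gen y).
Qed.

End Regular.

Lemma submodule_ext (R : nzRingType) (M : lmodType R) (S T : submodule M) :
  (forall x, S x <-> T x) -> S = T.
Proof.
case: S T => [S pS] [T pT] /= ST; have eST : S = T by apply/funext => x;
  exact/propext.
by rewrite eST in pS *; rewrite (Prop_irrelevance pS pT).
Qed.

(** * Nakayama algebras *)

(* [p i k] is the path of length [k] starting at the vertex [i] modulo [n]. *)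
Record nakayama (K : fieldType) (A : falgType K) (n : nat) (c : nat -> nat)
    (p : nat -> nat -> A) : Prop := Nakayama {
  nak_gt0 : (0 < n)%N;
  nak_per : forall i k, p (i + n)%N k = p i k;
  nak_mul : forall i k l, p i k * p (i + k)%N l = p i (k + l)%N;
  nak_mul0 : forall i k j l, i + k != j %[mod n] -> p i k * p j l = 0;
  nak_one : \sum_(i < n) p i 0%N = 1;
  nak_span : forall i x, exists a : nat -> K,
    p i 0%N * x = \sum_(k < c i) a k *: p i k;
  nak_eq0 : forall i k, (p i k == 0) = (c i <= k)%N;
  nak_ge2 : forall i, (2 <= c i)%N
}.

Section RightIdeal.
Variables (K : fieldType) (A : falgType K) (P : A -> Prop).
Hypothesis P_ideal : right_ideal P.

Lemma right_ideal_closed : P 0 /\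
  forall (a : A^c) (x y : (A^c)^o), P x -> P y -> P (a *: x + y).
Proof.
have [P0 PD PM] := P_ideal; split=> // a x y Px Py.
exact: (PD _ _ (PM x a Px) Py).
Qed.

Definition right_submodule : submodule (A^c)^o := Submodule right_ideal_closed.
End RightIdeal.

(** The first step of a heredity chain lives in a copy [B] of [A] modulo the zero ideal, so the path
    structure must be moved along an isomorphism. *)
Lemma nakayama_transfer (K : fieldType) (A B : falgType K) n c p
    (pi : {lrmorphism A -> B}) :
  (forall a, pi a = 0 -> a = 0) -> (forall b, exists a, pi a = b) ->
  @nakayama K A n c p -> @nakayama K B n c (fun i k => pi (p i k)).
Proof.
move=> pi0 pis [n0 per mul mul0 one span eq0 ge2];
  split=> // [i k|i k l|i k j l ne||i y|i k].
- by rewrite per.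
- by rewrite -rmorphM mul.
- by rewrite -rmorphM mul0 // rmorph0.
- by rewrite -rmorph_sum one rmorph1.
- have [x <-] := pis y; have [a aE] := span i x; exists a.
  by rewrite -rmorphM aE rmorph_sum; apply: eq_bigr => k _; exact: linearZ.
by rewrite -eq0; apply/eqP/eqP => [/pi0|->] //; rewrite rmorph0.
Qed.

Section Nakayama.
Variables (K : fieldType) (A : falgType K) (n : nat) (c : nat -> nat).
Variable p : nat -> nat -> A.
Hypothesis nakA : nakayama n c p.

Let n_gt0 := nak_gt0 nakA.
Let p_per := nak_per nakA.
Let p_mul := nak_mul nakA.
Let p_mul0 := nak_mul0 nakA.
Let p_eq0 := nak_eq0 nakA.
Let p_span := nak_span nakA.
Let c_ge2 := nak_ge2 nakA.
Let f x := (x + c x)%N.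

Implicit Types S : submodule (A^c)^o.

Lemma p_zero i k : (c i <= k)%N -> p i k = 0.
Proof. by rewrite -p_eq0 => /eqP. Qed.

Lemma nak_c_per i : c (i + n)%N = c i.
Proof.
by apply/eqP; rewrite eqn_leq -!p_eq0 p_per p_eq0 leqnn -p_per p_eq0 leqnn.
Qed.

(** Composing the arrow at [i] with the vanishing path of length [c i.+1] gives zero. *)
Lemma nak_c_mono i : (c i <= (c i.+1).+1)%N.
Proof.
rewrite -p_eq0 -add1n -p_mul addn1; apply/eqP.
by rewrite [X in _ * X]p_zero // mulr0.
Qed.

Lemma p_mod i k : p (i %% n) k = p i k.
Proof.
rewrite {2}(divn_eq i n) addnC; elim: (i %/ n)%N => [|m IH];
  first by rewrite mul0n addn0.
by rewrite mulSn addnCA addnC p_per.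
Qed.

Lemma p_mulE i k j l :
  p i k * p j l = if i + k == j %[mod n] then p i (k + l) else 0.
Proof.
case: ifP => [/eqP e|/negbT/p_mul0//].
by rewrite -(p_mod j) -e p_mod p_mul.
Qed.

Lemma p_idl i k : p i 0 * p i k = p i k.
Proof. by rewrite -{2}[i]addn0 p_mul. Qed.

Lemma p_idr i k : p i k * p (i + k) 0 = p i k.
Proof. by rewrite p_mul addn0. Qed.

(** * Right ideals inside an indecomposable projective *)

Section Submodules.
Variable S : submodule (A^c)^o.

Lemma sub0 : S 0. Proof. by case: (submem_closed S). Qed.

Lemma subD (x y : A) : S x -> S y -> S (x + y).
Proof.
move=> Sx Sy; have [_ SD] := submem_closed S.
by have := SD 1 x y Sx Sy; rewrite scale1r.
Qed.

Lemma subM (x y : A) : S x -> S (x * y).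
Proof.
move=> Sx; have [S0 SD] := submem_closed S.
by have := SD (y : A^c) x 0 Sx S0; rewrite addr0.
Qed.

Lemma subZ (a : K) (x : A) : S x -> S (a *: x).
Proof. by move=> Sx; rewrite -[x]mulr1 scalerAr; exact: subM. Qed.

Lemma subN (x : A) : S x -> S (- x).
Proof. by move=> Sx; rewrite -scaleN1r; exact: subZ. Qed.

Lemma sub_sum (I : Type) (r : seq I) (P : pred I) (F : I -> A) :
  (forall i, P i -> S (F i)) -> S (\sum_(i <- r | P i) F i).
Proof.
by move=> SF; elim/big_ind: _ => //; [exact: sub0|move=> x y; exact: subD].
Qed.

(** By descending induction on [j], every [p i j] with [m <= j] lies in [S]: multiplying the element
    by a path of length [j - m] turns its leading term into a nonzero multiple of [p i j] and the
    others into zero or longer paths, already in [S]. *)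
Lemma lead_mem i m a : (m < c i)%N -> (forall k, (k < m)%N -> a k = 0) ->
  a m != 0 -> S (\sum_(k < c i) a k *: p i k) -> S (p i m).
Proof.
move=> mc a0 am Sx.
suff main d j : (m <= j)%N -> (c i <= j + d)%N -> S (p i j).
  by apply: (main (c i)); lia.
elim: d j => [|d IHd] j mj jd.
  by rewrite p_zero; [exact: sub0|lia].
have := subM (p (i + m) (j - m)) Sx.
rewrite mulr_suml (bigD1 (Ordinal mc)) //= -scalerAl p_mul subnKC //.
set y := \sum_(_ | _) _ => Sy.
have Sy' : S y.
  apply: sub_sum => k km; rewrite -scalerAl.
  have [lt|ge] := ltnP k m; first by rewrite a0 // scale0r; exact: sub0.
  apply: subZ; rewrite p_mulE; case: ifP => _; last exact: sub0.
  by apply: IHd; move: km; rewrite -val_eqE /=; lia.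
rewrite -[p i j]scale1r -(mulVf am) -scalerA; apply: subZ.
by rewrite -[_ *: _](addrK y); apply: subD => //; exact: subN.
Qed.

(** The least length of a path from [i] in [S] serves as [m], with [c i] standing for the zero
    submodule. By [lead_mem], elements of [S] have no shorter terms. *)
Lemma uniserial i : (forall x : A, S x -> p i 0 * x = x) ->
  exists2 m, (m <= c i)%N & forall x : A, S x <-> exists a, x = p i m * a.
Proof.
move=> Si.
have exm : exists m, `[< S (p i m) >].
  by exists (c i); apply/asboolP; rewrite p_zero //; exact: sub0.
case: (ex_minnP exm) => m /asboolP Sm minm; exists m.
  by apply: minm; apply/asboolP; rewrite p_zero //; exact: sub0.
move=> x; split=> [Sx|[a ->]]; last exact: subM.
have [a xE] := p_span i x; rewrite (Si x Sx) in xE.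
have a0 k : (k < m)%N -> (k < c i)%N -> a k = 0.
  elim/ltn_ind: k => k IH km kc; apply/eqP/negPn/negP => ak.
  suff /asboolP/minm : S (p i k) by rewrite leqNgt km.
  by apply: (@lead_mem i k a); rewrite -?xE // => j jk; apply: IH => //; lia.
exists (\sum_(k < c i) a k *: p (i + m) (k - m)).
rewrite xE mulr_sumr; apply: eq_bigr => k _.
have [km|mk] := ltnP k m; first by rewrite a0 // !scale0r mulr0.
by rewrite -scalerAr p_mul subnKC.
Qed.

End Submodules.

(** A relation is an element of the zero submodule, so by [lead_mem] its first nonzero coefficient
    would make a path of length below [c i] vanish. *)
Lemma p_free i (a : nat -> K) : \sum_(k < c i) a k *: p i k = 0 ->
  forall k, (k < c i)%N -> a k = 0.
Proof.
move=> sum0; have zero_ideal : right_ideal (fun x : A => x = 0).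
  by split=> // [x y -> ->|x y ->]; rewrite ?addr0 ?mul0r.
elim/ltn_ind=> k IH kc; apply/eqP/negPn/negP => ak.
have := @lead_mem (right_submodule zero_ideal) i k a kc _ ak sum0.
move=> /(_ (fun j jk => IH j jk (ltn_trans jk kc)))/eqP.
by rewrite p_eq0 leqNgt kc.
Qed.

Lemma dim_vertex i : \dim (<[p i 0]> * {:A}) = c i.
Proof.
pose X := mkseq (p i) (c i).
have -> : (<[p i 0]> * {:A} = <<X>>)%VS.
  apply: subv_anti; apply/andP; split.
    apply/prodvP => _ x /vlineP[b ->] _; rewrite -scalerAl memvZ //.
    have [a ->] := p_span i x; apply: memv_suml => k _; apply: memvZ.
    by apply: memv_span; apply/mapP; exists (k : nat);
      rewrite ?mem_iota /= ?ltn_ord.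
  apply/span_subvP => _ /mapP[k _ ->].
  by rewrite -p_idl memv_mul ?memv_line ?memvf.
suff /eqP -> : free X by rewrite size_mkseq.
have -> : X = [tuple p i k | k < c i] :> seq A.
  by rewrite /X /mkseq -val_enum_ord -map_comp.
apply/freeP => a a0 k.
have := @p_free i (fun j => if insub j is Some j' then a j' else 0) _ k
  (ltn_ord k).
rewrite valK; apply; rewrite -[RHS]a0; apply: eq_bigr => j _.
by rewrite valK -tnth_nth tnth_mktuple.
Qed.

(** Over the converse ring [lideal] is a right ideal of [A]; this one is the interval from [i + k]
    to [f i], the latter excluded. *)
Definition path_ideal i k : submodule (A^c)^o := lideal (p i k : A^c).

Lemma path_idealP i k (x : A) : path_ideal i k x <-> exists a, x = p i k * a.
Proof. by []. Qed.

Lemma path_ideal_le i k m : (k <= m)%N -> forall x : A, path_ideal i m x ->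
  path_ideal i k x.
Proof.
move=> km x [a ->]; exists (p (i + k) (m - k) * a : A).
by rewrite -[RHS]/(p i k * (p (i + k) (m - k) * a)) mulrA p_mul subnKC.
Qed.

Lemma path_ideal_idl i k (x : A) : path_ideal i k x -> p i 0 * x = x.
Proof. by move=> [a ->]; rewrite -[LHS]/(p i 0 * (p i k * a)) mulrA p_idl. Qed.

(** If [m < k], extend [p i m] to the nonzero path of length [(c i).-1]; through [p i k] all its
    terms would have length at least [c i]. *)
Lemma path_ideal_min i k m : (m < c i)%N -> path_ideal i k (p i m) -> (k <=
  m)%N.
Proof.
move=> mc [a]; rewrite -[a * _]/(p i k * (a : A)) => e; rewrite leqNgt;
  apply/negP => mk.
have [b bE] := p_span (i + k) a.
suff : p i (c i).-1 == 0 by rewrite p_eq0; lia.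
have -> : p i (c i).-1 = p i m * p (i + m) ((c i).-1 - m).
  by rewrite p_mul subnKC //; lia.
rewrite e -(p_idr i k) -(mulrA (p i k)) bE mulr_sumr mulr_suml big1 // => q _.
rewrite -scalerAr p_mul -scalerAl p_mulE; case: ifP => _; last exact: scaler0.
by rewrite p_zero ?scaler0 //; lia.
Qed.

Lemma path_ideal_fgproj i : fgproj (submod (path_ideal i 0)).
Proof. by apply: lideal_fgproj; exact: (p_idl i 0). Qed.

(** * Covers and syzygies of intervals *)

Section LeftMultiplication.
Variables i k : nat.

Lemma lmul_linear : linear (fun x : (A^c)^o => (p i k * x : A) : (A^c)^o).
Proof.
move=> a x y; have := mulrDr (p i k) ((x : A) * (a : A)) (y : A).
by rewrite mulrA.
Qed.

Definition lmul := linear_of lmul_linear.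

Lemma lmulP (x : submod (path_ideal (i + k) 0)) :
  path_ideal i k ((lmul \o incl _) x).
Proof. by exists (incl (path_ideal (i + k) 0) x). Qed.

Definition cover := corestr lmulP.

Lemma coverE (x : submod (path_ideal (i + k) 0)) : incl _ (cover x) = p i k *
  incl _ x. Proof. by []. Qed.

Lemma cover_surj : surj cover.
Proof.
move=> y; have [a yE] := inclP y.
have [x xE] : exists x, incl (path_ideal (i + k) 0) x = (p (i + k) 0 * a : A).
  by apply: incl_surj; exists a.
exists x; apply: (@incl_inj _ _ (path_ideal i k)); rewrite coverE xE yE.
by rewrite -[RHS]/(p i k * a) mulrA p_idr.
Qed.

Definition syzygy_incl : {linear submod (path_ideal (i + k) (c i - k)) ->
    submod (path_ideal (i + k) 0)} :=
  corestr (fun x => path_ideal_le (leq0n _) (inclP x)).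

(** The kernel is a right ideal in the projective at [i + k], hence generated by a path by
    [uniserial]; a path of length [m] is killed only if [c i <= k + m]. *)
Lemma cover_exact : (k <= c i)%N -> short_exact syzygy_incl cover.
Proof.
move=> kc; split=> [x y|| x]; last 1 first.
- split=> [x0|[y <-]]; last first.
    apply: (@incl_inj _ _ (path_ideal i k)); rewrite coverE linear0.
    have -> : incl _ (syzygy_incl y) = incl _ y by [].
    have [a ->] := inclP y; rewrite -[LHS]/(p i k * (p (i + k) (c i - k) * a)).
    by rewrite mulrA p_mul p_zero ?mul0r //; lia.
  have kerc : right_ideal (fun z : A => p i k * z = 0 /\ p (i + k) 0 * z = z).
    split=> [|u v [u0 uE] [v0 vE]|u a [u0 uE]]; first by rewrite !mulr0.
      by rewrite !mulrDr u0 v0 uE vE addr0.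
    by rewrite !mulrA u0 uE mul0r.
  have [m mc kerE] := @uniserial (right_submodule kerc) (i + k) (fun x h =>
    h.2).
  have /kerE[a xE] : right_submodule kerc (incl _ x).
    split; last exact: path_ideal_idl (inclP x).
    by rewrite -coverE x0 linear0.
  have [pm0 _] := (kerE (p (i + k) m)).2 (ex_intro _ 1 (esym (mulr1 _))).
  have mk : (c i - k <= m)%N by move: pm0 => /eqP; rewrite p_mul p_eq0; lia.
  have [y yE] : exists y, incl (path_ideal (i + k) (c i - k)) y = incl _ x.
    by apply: incl_surj; apply: (path_ideal_le mk); exists a.
  by exists y; apply: (@incl_inj _ _ (path_ideal (i + k) 0)); rewrite corestrK.
- by move=> /(congr1 (@incl _ _ _)); rewrite !corestrK => /incl_inj.
exact: cover_surj.
Qed.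

End LeftMultiplication.

(** By [cover_exact], passing to the syzygy replaces [(a, b)] by [(b, f a)]; a pair with [b = f a]
    gives the zero module. *)
Lemma stops_pdlt d a b : (a <= b <= f a)%N -> stops c d a b ->
  pdlt d (submod (path_ideal a (b - a))).
Proof.
have zero x y : (y = f x)%N -> pdlt 0 (submod (path_ideal x (y - x))).
  move=> -> u; apply: (@incl_inj _ _ (path_ideal x (f x - x))).
  have [z ->] := inclP u; rewrite linear0 -[LHS]/(p x _ * z).
  by rewrite p_zero ?mul0r // /f; lia.
elim: d a b => [|d IHd] a b ab; rewrite [stops _ _ _ _]/=.
  by rewrite orbF => /eqP; exact: zero.
case/orP=> [/eqP bf|st]; first exact/(leq_pdlt (leq0n _))/zero.
exists (submod (path_ideal (a + (b - a)) 0)), _, (syzygy_incl a (b - a)),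
  (cover a (b - a)).
have cba : (b - a <= c a)%N by rewrite /f in ab; lia.
split; [exact: path_ideal_fgproj|exact: cover_exact|].
have -> : (a + (b - a) = b)%N by lia.
have -> : (c a - (b - a) = f a - b)%N by rewrite /f; lia.
apply: IHd => //; have := cover_end_mono nak_c_mono (x := a) (y := b).
by rewrite /f; lia.
Qed.

Lemma gldim_stops d t :
  (forall a b, (t <= a < t + n)%N -> (a <= b <= f a)%N -> stops c d a b) ->
  gldim_le A d.
Proof.
move=> st M fgM; apply: pdlt_proj_dim_le.
apply: (@fin_generated_pdlt (A^c) d n (fun i => p i 0)) fgM;
  first exact: nak_one nakA.
move=> i S Si.
have [m mc SE] : exists2 m, (m <= c i)%N & forall x : A, S x <-> exists a, x =
  p i m * a.
  apply: uniserial => x /Si[a ->].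
  by rewrite -[LHS]/(p i 0 * (p i 0 * (a : A))) mulrA p_idl.
have [j [/andP[tj jn] ij]] : exists j, (t <= j < t + n)%N /\ i = j %[mod n].
  (* The offset from [t] is [i - t] reduced modulo [n]. *)
  exists (t + (i + (n - t %% n)) %% n)%N;
    rewrite leq_addr ltn_add2l ltn_mod n_gt0.
  split=> //; rewrite modnDmr -modnDml addnCA subnKC ?modnDr //.
  by rewrite ltnW // ltn_mod.
have pij k : p i k = p j k by rewrite -p_mod ij p_mod.
have cij : c i = c j.
  by apply/eqP; rewrite eqn_leq -!p_eq0 pij p_eq0 leqnn -pij p_eq0 leqnn.
have -> : S = path_ideal j m.
  by apply: submodule_ext => x; apply: iff_trans (SE x) _; rewrite pij.
have -> : m = (j + m - j)%N by lia.
by apply: stops_pdlt; [rewrite /f|apply: st; rewrite /f]; lia.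
Qed.

(* Multiplying by a complementary path isolates the coefficient of the vertex. *)
Lemma p_mul_lead k m t (a : nat -> K) : (k + m = t)%N -> (m < c k)%N ->
  p k m * (\sum_(j < c t) a j *: p t j) * p t (c k - m).-1
    = a 0%N *: p k (c k).-1.
Proof.
move=> <- mc; have cgt0 : (0 < c (k + m))%N by exact: ltnW (c_ge2 _).
rewrite mulr_sumr mulr_suml (bigD1 (Ordinal cgt0)) //= big1 ?addr0.
  by rewrite -scalerAr p_mul -scalerAl addn0 p_mul; congr (_ *: p _ _); lia.
move=> j; rewrite -val_eqE /= => j0.
rewrite -scalerAr p_mul -scalerAl p_mulE; case: ifP => _; last exact: scaler0.
by rewrite p_zero ?scaler0 //; lia.
Qed.

(** The map [u], followed by left multiplication with [p k 0], lifts along the cover; the value [z]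
    at [q0] satisfies [p k m * z = p k m], so its coefficient at the vertex is nonzero. As [u] is
    injective, [z] is killed by the path that kills [p k m]; if the projective at [k + m] ended
    later, that coefficient would be 0. *)
Lemma projective_interval (P : lmodType A^c) (u : {linear P -> (A^c)^o}) (q0 :
  P) k m :
  projective P -> injective u -> (forall q, path_ideal k m (p k 0 * u q : A)) ->
  u q0 = p k m -> (m < c k)%N -> (f (k + m) <= f k)%N.
Proof.
move=> prP inj_u uP uq0 mc; rewrite leqNgt; apply/negP => lt.
have [h hE] := prP _ _ (cover k m) (corestr (g := lmul k 0 \o u) uP)
  (@cover_surj k m).
pose z : A := incl _ (h q0).
have pz : p k m * z = p k m.
  rewrite -coverE hE corestrK -[LHS]/(p k 0 * u q0) uq0.
  by rewrite p_idl.
have zl : z * p (k + m) (c k - m) = 0.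
  have e0 : (p (k + m) (c k - m) : A^c) *: q0 = 0.
    apply: inj_u; rewrite linear0 linearZ uq0.
    by rewrite -[LHS]/(p k m * p (k + m) (c k - m)) p_mul p_zero //; lia.
  by have := congr1 (fun q => incl _ (h q)) e0; rewrite !linear0 !linearZ.
have [a aE] := p_span (k + m) z.
have zE : z = p (k + m) 0 * z by rewrite (path_ideal_idl (inclP (h q0))).
have a1 := p_mul_lead a erefl mc.
have a0 := p_mul_lead a (addn0 (k + m)) (ltnW (c_ge2 _)).
rewrite -aE -zE pz p_mul in a1; rewrite -aE -zE -zE subn0 in a0.
have pk : p k (c k).-1 != 0 by rewrite p_eq0; have := c_ge2 k; lia.
have pt : p (k + m) (c (k + m)).-1 != 0.
  by rewrite p_eq0; have := c_ge2 (k + m); lia.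
have zp : z * p (k + m) (c (k + m)).-1 = 0.
  have -> : ((c (k + m)).-1 = c k - m + ((c (k + m)).-1 - (c k - m)))%N.
    by rewrite /f in lt; lia.
  by rewrite -p_mul mulrA zl mul0r.
move/eqP: a0; rewrite zp eq_sym scaler_eq0 (negbTE pt) orbF => /eqP a00.
move/eqP: a1; rewrite a00 scale0r p_eq0; lia.
Qed.

(** If [I + p t l * A] contained 1, multiplying this expression of 1 by a path would express the
    path modulo [I] by longer ones. Long paths vanish, so all vertices, and hence 1, would lie in
    [I]. *)
Lemma path_jacobson t l : (0 < l)%N -> jacobson_radical (p t l).
Proof.
move=> l0 I [[I0 ID IM] I1 maxI].
pose J (x : A) := exists i a, I i /\ x = i + p t l * a.
apply: (maxI J); last first.
- by exists 0, 1; rewrite mulr1 add0r.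
- move=> [i [a [Ii e1]]]; apply: I1.
  have I_Z (b : K) (x : A) : I x -> I (b *: x).
    by move=> Ix; rewrite -[x]mulr1 scalerAr; exact: IM.
  have I_sum (T : Type) (r : seq T) (F : T -> A) :
      (forall j, I (F j)) -> I (\sum_(j <- r) F j).
    by move=> IF; elim/big_ind: _ => //.
  suff main d s k : (\max_(j < n) c j <= k + d)%N -> I (p s k).
    by rewrite -(nak_one nakA); apply: I_sum => s;
      exact: (main _ s 0%N (leqnn _)).
  elim: d s k => [|d IHd] s k; rewrite ?addn0 => ck.
    rewrite -p_mod p_zero // (leq_trans _ ck) //.
    exact: (leq_bigmax (Ordinal (ltn_pmod s n_gt0))).
  rewrite -[p s k]mul1r e1 mulrDl; apply: ID; first exact: IM.
  have [b bE] := p_span (t + l) a.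
  rewrite -(p_idr t l) -(mulrA (p t l)) bE mulr_sumr mulr_suml;
    apply: I_sum => q.
  rewrite -scalerAr -scalerAl; apply: I_Z; rewrite p_mul p_mulE;
    case: ifP => // _.
  by apply: IHd; lia.
- by move=> x Ix; exists x, 0; rewrite mulr0 addr0.
split.
- by exists 0, 0; rewrite mulr0 addr0.
- move=> _ _ [i [a [Ii ->]]] [i' [a' [Ii' ->]]]; exists (i + i'), (a + a').
  by rewrite mulrDr addrACA; split=> //; exact: ID.
- move=> _ y [i [a [Ii ->]]]; exists (i * y), (a * y).
  by rewrite mulrDl mulrA; split=> //; exact: IM.
Qed.

Lemma heredity_vertex (J : {vspace A}) : heredity_ideal J -> J <> 0%VS ->
  exists2 t, (c t <= n)%N &
    forall k, (t < k < t + n)%N -> (f k <= t + n)%N \/ f k = f (t + n).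
Proof.
move=> [[J0 JD JM] [P [u [prP inj_u uJ]]] JJ Jrad] Jn0.
have SP k : right_ideal (fun x : A => x \in J /\ p k 0 * x = x).
  split=> [|x y [Jx xE] [Jy yE]|x a [Jx xE]]; first by rewrite mulr0.
    by rewrite mulrDr xE yE; split=> //; exact: JD.
  by rewrite mulrA xE; split=> //; exact: (JM a x Jx).2.
have gen k : exists2 m, (m <= c k)%N &
    forall x : A, (x \in J /\ p k 0 * x = x) <-> exists a, x = p k m * a.
  exact: (@uniserial (right_submodule (SP k)) k (fun x h => h.2)).
have genJ k m : (forall x : A, (x \in J /\ p k 0 * x = x) <-> exists a, x = p k
  m * a) ->
    p k m \in J.
  by move=> mE; have [] := (mE (p k m)).2 (ex_intro _ 1 (esym (mulr1 _))).
(* Let [m'] be the exponent at the end vertex [k + m]. Then [p k 0 * (J * J)] lies in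
   [p k (m + m') * A]; since [J * J = J] it contains [p k m], so [m' = 0]. *)
have idem k m : (forall x : A, (x \in J /\ p k 0 * x = x) <-> exists a, x = p k
  m * a) ->
    (m < c k)%N -> p (k + m) 0 \in J.
  move=> mE mc; have [m' m'c m'E] := gen (k + m)%N.
  have Jm := genJ _ _ mE; have Jm' := genJ _ _ m'E.
  have amullE (v w : A) : amull v w = v * w by rewrite lfunE.
  pose W := (amull (p k 0) @^-1: (amull (p k (m + m')) @: fullv))%VS.
  have /subvP JW : (J * J <= W)%VS.
    apply/prodvP => x y Jx Jy; rewrite -memv_preim; apply/memv_imgP.
    have [xk xE] : exists a, p k 0 * x = p k m * a.
      by apply/mE; rewrite mulrA p_idl; split=> //; exact: (JM (p k 0) x Jx).1.
    have [b bE] : exists b, p (k + m) 0 * (xk * y) = p (k + m) m' * b.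
      apply/m'E; split; last by rewrite mulrA p_idl.
      exact: (JM (p (k + m) 0) _ (JM xk y Jy).1).1.
    exists b; rewrite ?memvf // !amullE mulrA xE -(p_idr k m) -!mulrA bE.
    by rewrite mulrA p_mul.
  have := JW (p k m); rewrite JJ Jm => /(_ isT).
  rewrite -memv_preim => /memv_imgP[a _]; rewrite !amullE p_idl => pkm.
  have := @path_ideal_min k (m + m') m mc;
    rewrite pkm => /(_ (ex_intro _ a erefl)) le_mm'.
  by have m0 : m' = 0%N; [lia|rewrite m0 in Jm'].
have [t0 [m [mE mc]]] : exists t0 m,
    (forall x : A, (x \in J /\ p t0 0 * x = x) <-> exists a, x = p t0 m * a) /\
      (m < c t0)%N.
  have [x Jx x0] : exists2 x, x \in J & x != 0.
    by exists (vpick J); [exact: memv_pick|rewrite vpick0; apply/eqP].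
  have [i xi] : exists i : 'I_n, p i 0 * x != 0.
    case: (pickP (fun i : 'I_n => p i 0 * x != 0)) => [i xi|all0].
      by exists i.
    case/eqP: x0.
    rewrite -[x]mul1r -(nak_one nakA) mulr_suml big1 // => i _.
    exact/eqP/negbFE/(all0 i).
  have [m mc mE] := gen i; exists i, m; split=> //.
  rewrite ltn_neqAle mc andbT; apply: contra_neq xi => mci.
  have [a ->] : exists a, p i 0 * x = p i m * a.
    by apply/mE; rewrite mulrA p_idl; split=> //; exact: (JM (p i 0) x Jx).1.
  by rewrite p_zero ?mul0r // mci.
pose t := (t0 + m)%N; have Jt : p t 0 \in J := idem _ _ mE mc.
have pn0 k : p (k + n) 0 = p k 0 by exact: p_per.
(* A path of length [n] from [t] returns to [t], so it lies in [J rad(A) J]. *)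
exists t; first by rewrite -p_eq0 -(p_idl t n) -(p_idr t n) pn0 mulrA Jrad //;
  exact: path_jacobson.
move=> k /andP[tk kn]; have [le|lt] := leqP (f k) (t + n); [by left|right].
pose l := (t + n - k)%N; have kl : (k + l = t + n)%N by rewrite /l; lia.
have lc : (l < c k)%N by rewrite /f in lt; lia.
have [m' m'c m'E] := gen k.
have Jl : p k l \in J by rewrite -p_idr kl pn0; exact: (JM _ _ Jt).1.
have [a pkl] : exists a, p k l = p k m' * a by apply/m'E; rewrite p_idl.
have m'l : (m' <= l)%N by apply: (@path_ideal_min k m' l lc); exists a.
(* A generator shorter than [l] would have its end vertex in [J], and [p k l] would factor through
   the radical between two idempotents of [J]. *)
have m'_l : m' = l.
  apply/eqP; rewrite eqn_leq m'l leqNgt; apply/negP => lt_m'l.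
  have Jm' : p (k + m') 0 \in J by apply: idem m'E _; lia.
  suff : p k l == 0 by rewrite p_eq0; lia.
  have -> : p k l = p k m' * (p (k + m') 0 * p (k + m') (l - m') * p t 0).
    rewrite p_idl -(pn0 t) (_ : t + n = k + m' + (l - m'))%N; last by lia.
    by rewrite p_idr p_mul subnKC.
  by rewrite Jrad ?mulr0 //; apply: path_jacobson; lia.
have [q0 q0E] := (uJ (p k l)).1 Jl.
(* With [p k 0 * J] generated by [p k l], projectivity of [J] compares the two ends. *)
have le : (f (k + l) <= f k)%N.
  apply: (projective_interval (u := u) (q0 := q0) prP inj_u) => // q.
  have Jq : u q \in J by apply/uJ; exists q.
  rewrite -m'_l; apply/path_idealP/m'E; rewrite mulrA p_idl; split=> //.
  exact: (JM (p k 0) (u q) Jq).1.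
apply/eqP; rewrite eqn_leq -{2}kl le andbT;
  apply: cover_end_mono nak_c_mono _ _ _.
by lia.
Qed.

(* For the Kupisch series [2,...,2,3] the syzygies of the simple top of the
   first projective are the simples at the following vertices; the last one
   is not projective. *)
Lemma gldim_lower t : (2 <= n)%N ->
  (forall j, (j.+2 <= n)%N -> c (t + j) = 2%N) -> c (t + n.-1) = 3%N ->
  ~ gldim_le A n.-1.
Proof.
move=> n2 c2 c3 gl.
have ct k : (1 <= c k)%N by exact: ltnW (c_ge2 k).
pose i : {linear submod (path_ideal t 1) -> submod (path_ideal t 0)} :=
  corestr (fun x => path_ideal_le (leq0n _) (inclP x)).
(* This quotient is the simple module at [t]. *)
pose g := qproj (immod i).
have ex : short_exact i g.
  have [inj_I gs gE] := quotmod_exact (immod i); split=> // [x y|x].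
    by move=> /(congr1 (@incl _ _ _)); rewrite !corestrK => /incl_inj.
  apply: iff_trans (gE x) _; split=> [[y <-]|/(incl_surj (S := immod i))//].
  exact: (@inclP _ _ (immod i) y).
have prt := path_ideal_fgproj t.
have fgM : fin_generated (quotmod (immod i)).
  by case: ex => _ gs _; exact: fin_generated_surj gs prt.1.
have := proj_dim_le_pdlt (gl _ fgM); rewrite prednK // => pdM.
(* Schanuel's lemma is iterated at the cost of a projective summand [P]. Since [c (t + j) = 2],
   covering the radical at [t + j] leaves the radical at [t + j.+1] as kernel. *)
have syz j : (j.+2 <= n)%N -> exists2 P, fgproj P &
    pdlt (n.-1 - j) (submod (path_ideal (t + j) 1) * P)%type.
  elim: j => [|j IHj] jn.
    rewrite addn0 subn0; apply: (pdlt_syzygy _ ex prt prt); first by lia.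
    rewrite prednK //; apply: pdlt_prod pdM _;
      apply: leq_pdlt _ (proj_pdlt1 prt).
    exact: n_gt0.
  have [P prP pdP] := IHj (ltnW jn).
  have exj := @cover_exact (t + j) 1 (ct _).
  rewrite (_ : n.-1 - j = (n.-1 - j.+1).+1)%N in pdP; last by lia.
  have [P' prP' pdP'] := pdlt_syzygy (d := n.-1 - j.+1) ltac:(lia) exj
    (path_ideal_fgproj _) prP pdP.
  by exists P' => //; rewrite (c2 j (ltnW jn)) -addnA addn1 in pdP'.
have [P prP] := syz n.-2 ltac:(lia).
rewrite (_ : n.-1 - n.-2 = 1)%N; last by lia.
move=> /pdlt1_proj[_ pr].
have prI : projective (submod (path_ideal (t + n.-2) 1)).
  exact: (projective_retract (s := linl _ P) (r := lfst _ P)) pr.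
have [q0 q0E] := incl_surj (lideal_self (p (t + n.-2) 1 : A^c)).
have c2' := c2 n.-2 ltac:(lia).
(* Projectivity would require [t + n + 2 <= t + n]. *)
have := projective_interval (u := incl _) (q0 := q0) prI (@incl_inj _ _ _) _
  q0E.
rewrite c2' /f c2' (_ : t + n.-2 + 1 = t + n.-1)%N ?c3; last by lia.
have H q : path_ideal (t + n.-2) 1 (p (t + n.-2) 0 * incl (path_ideal (t +
  n.-2) 1) q : A).
  by rewrite (path_ideal_idl (inclP q)); exact: inclP.
by move=> /(_ H isT); lia.
Qed.

End Nakayama.

(** Since [J 0 = 0], the first quotient [B] is isomorphic to [A], and the image of [J 1] in it is a
    nonzero heredity ideal. *)
Lemma quasi_hereditary_vertex (K : fieldType) (A : falgType K) n c p :
  @nakayama K A n c p -> quasi_hereditary A ->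
  exists2 t, (c t <= n)%N & forall k, (t < k < t + n)%N ->
    (k + c k <= t + n)%N \/ (k + c k = t + n + c (t + n))%N.
Proof.
move=> nakA [m [J [J0 Jm _ Jstep]]].
have m_gt0 : (0 < m)%N.
  rewrite lt0n; apply/eqP => m0; move: Jm; rewrite m0 J0 => zf.
  by have := memvf (1 : A); rewrite -zf memv0 oner_eq0.
have [_ Jne [B [pi [pis pi0 her]]]] := Jstep 0%N m_gt0.
have pi_inj a : pi a = 0 -> a = 0 by move/pi0; rewrite J0 memv0 => /eqP.
suff J1 : (linfun pi @: J 1%N)%VS <> 0%VS.
  exact: (heredity_vertex (nakayama_transfer pi_inj pis nakA) her J1).
move=> im0; apply: Jne; apply/eqP; rewrite J0 eq_sym -subv0;
  apply/subvP => x Jx.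
rewrite memv0; apply/eqP/pi_inj/eqP; rewrite -memv0 -im0.
by have := memv_img (linfun pi) Jx; rewrite lfunE.
Qed.

(** * The presentation by the cyclic quiver *)

Section CyclicPaths.
Variables (n : nat) (n_gt0 : (0 < n)%N).
Let Q := cyclic_quiver n_gt0.

Definition cyc_vertex i : 'I_n := Ordinal (ltn_pmod i n_gt0).

Lemma ordS_cyc_vertex i : ordS (cyc_vertex i) = cyc_vertex i.+1.
Proof. by apply: val_inj; rewrite /= -addn1 modnDml addn1. Qed.

Lemma cyc_vertex_ord (i : 'I_n) : cyc_vertex i = i.
Proof. by apply: val_inj; rewrite /= modn_small. Qed.

Lemma walk_cyc i k : walk (Q := Q) (cyc_vertex i) [seq cyc_vertex j | j <- iota
  i k].
Proof.
by elim: k i => [|k IHk] i //=; rewrite eqxx ordS_cyc_vertex IHk.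
Qed.

(** An arrow of [cyclic_quiver] is named by its source, so the arrows of a path are the vertices it
    leaves. *)
Definition cyc_path i k : qpath Q := @QPath Q (_, _) (walk_cyc i k).

Lemma ptarget_cyc i k : ptarget (cyc_path i k) = cyc_vertex (i + k).
Proof.
rewrite /ptarget /=; elim: k i => [|k IHk] i /=; first by rewrite addn0.
by rewrite ordS_cyc_vertex IHk addSnnS.
Qed.

Lemma qpath_cyc (q : qpath Q) i : psource q = cyc_vertex i ->
  q = cyc_path i (plength q).
Proof.
case: q => -[v s] w /=; rewrite /psource /plength /= => vE;
  apply: val_inj => /=.
congr pair; first exact: vE.
elim: s v i vE w => //= a s IHs v i -> /andP[/eqP -> w].
by rewrite -(IHs _ i.+1 _ w) //; exact: ordS_cyc_vertex.
Qed.

End CyclicPaths.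

Section Presentation.
Variables (K : fieldType) (n : nat) (n_gt0 : (0 < n)%N) (A : falgType K).
Variable phi : {lrmorphism path_algebra K (cyclic_quiver n_gt0) -> A}.
Hypothesis phiP : admissible_presentation phi.

Definition path_image i k : A := phi (kq_path K (cyc_path n_gt0 i k)).

Local Notation p := path_image.

Lemma phi_mul (q r : qpath (cyclic_quiver n_gt0)) :
  phi (kq_path K q) * phi (kq_path K r) = phi (path_mul K q r).
Proof.
have e : kq_path K q * kq_path K r = path_mul K q r by exact: kq_mulUU.
by rewrite -rmorphM e.
Qed.

Lemma path_imageM i k l : p i k * p (i + k) l = p i (k + l).
Proof.
have e : ptarget (cyc_path n_gt0 i k) == psource (cyc_path n_gt0 (i + k) l).
  by rewrite ptarget_cyc.
rewrite /p phi_mul (path_mulT _ e); congr (phi (kq_path _ _)).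
by apply: val_inj; rewrite /= iotaD map_cat.
Qed.

Lemma path_imageM0 i k j l : i + k != j %[mod n] -> p i k * p j l = 0.
Proof.
move=> ne; rewrite /p phi_mul path_mulF ?rmorph0 // ptarget_cyc.
by rewrite -val_eqE.
Qed.

(** The value [c i] is the least length of a vanishing path from [i], which exists because the
    kernel contains all long paths. *)
Lemma presentation_nakayama : exists c, nakayama n c p.
Proof.
have [phis [_ [m m2 phi0] phi2]] := phiP.
have pm i k : (m <= k)%N -> p i k = 0.
  move=> mk; apply: phi0 => q /(fsubsetP (msupp_path _ _)).
  by rewrite inE => /eqP ->; rewrite /plength /= size_map size_iota.
have per i k : p (i + n) k = p i k.
  rewrite /p; congr (phi (kq_path _ _)).
  rewrite [RHS](qpath_cyc (i := i + n)) ?{1}/plength /= ?size_map ?size_iota //.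
  by apply: val_inj; rewrite /= modnDr.
have /choice[c p_eq0] : forall i, exists c, forall k, (p i k == 0) = (c <= k)%N.
  move=> i; have exz : exists k, p i k == 0 by exists m; rewrite pm.
  case: (ex_minnP exz) => c /eqP pc minc; exists c => k;
    apply/idP/idP => [/minc//|ck].
  by rewrite -(subnKC ck) -path_imageM pc mul0r.
exists c; split=> //; [exact: path_imageM|exact: path_imageM0| | |].
- transitivity (phi (kq_one K (cyclic_quiver n_gt0))); last exact: rmorph1.
  rewrite rmorph_sum.
  apply: eq_bigr => i _; congr (phi (kq_path _ _)).
  by apply: val_inj; rewrite /= cyc_vertex_ord.
- move=> i x; have [g <-] := phis x; rewrite (kqE g) rmorph_sum mulr_sumr.
  elim/big_ind: _ => [|_ _ [a ->] [b ->]|q _].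
  + by exists (fun=> 0); rewrite big1 // => k _; rewrite scale0r.
  + exists (fun k => a k + b k); rewrite -big_split; apply: eq_bigr => k _.
    by rewrite scalerDl.
  have zero : exists a : nat -> K, 0 = \sum_(k < c i) a k *: p i k.
    by exists (fun=> 0); rewrite big1 // => k _; rewrite scale0r.
  rewrite [X in _ * X](_ : _ = g@_q *: phi (kq_path K q)); last exact: linearZ.
  rewrite -scalerAr.
  have [sq|nsq] := eqVneq (psource q) (cyc_vertex n_gt0 i); last first.
    rewrite phi_mul path_mulF ?rmorph0 ?scaler0 // ptarget_cyc addn0 eq_sym //.
  have -> : phi (kq_path K q) = p (i + 0) (plength q) by rewrite addn0
    {1}(qpath_cyc sq).
  rewrite path_imageM add0n.
  have [lc|cl] := ltnP (plength q) (c i); last first.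
    by move: cl; rewrite -p_eq0 => /eqP ->; rewrite scaler0.
  exists (fun k => if k == plength q then g@_q else 0).
  rewrite (bigD1 (Ordinal lc)) //= eqxx big1 ?addr0 // => k.
  by rewrite -val_eqE /= => /negbTE ->; rewrite scale0r.
(* An arrow with image zero would lie in the square of the arrow ideal. *)
move=> i; rewrite ltnNge -p_eq0;
  apply/negP => /eqP /phi2 /(_ (cyc_path n_gt0 i 1)).
rewrite -mcoeff_neq0 mcoeff_path eqxx oner_eq0 => /(_ isT).
by [].
Qed.

Lemma kupisch_nakayama c : nakayama n c p -> kupisch_series phi = mkseq c n.
Proof.
move=> nakA; rewrite /kupisch_series /mkseq -val_enum_ord -map_comp.
apply: eq_map => i /=; rewrite /vertex_projective -(dim_vertex nakA i).
congr (\dim (<[phi (kq_path K _)]> * _)).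
by apply: val_inj; rewrite /= cyc_vertex_ord.
Qed.

End Presentation.

(** Rotation by [k] puts entry [x + k] modulo [n] of the list at position [x], so the block starts
    at [t = n - k]. *)
Lemma rot_kupisch (n : nat) (c : nat -> nat) : (2 <= n)%N ->
  (forall x, c (x + n)%N = c x) ->
  (exists k, mkseq c n = rot k (rcons (nseq n.-1 2) 3)) <->
  (exists t, (forall x, (t <= x)%N -> (x.+2 <= t + n)%N -> c x = 2%N) /\
     c (t + n).-1 = 3%N).
Proof.
move=> n2 per.
set L := rcons _ _.
have sL : size L = n by rewrite size_rcons size_nseq; lia.
have c_mod x : c (x %% n)%N = c x.
  rewrite {2}(divn_eq x n) addnC; elim: (x %/ n)%N => [|m IH];
    first by rewrite mul0n addn0.
  by rewrite mulSn addnCA addnC per.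
have nthL j : (j < n)%N -> nth 0%N L j = if (j.+1 < n)%N then 2%N else 3%N.
  move=> jn; rewrite nth_rcons size_nseq nth_nseq.
  case: ifP; case: ifP; case: ifP; lia.
have nth_rot k i : (k <= n)%N -> (i < n)%N -> nth 0%N (rot k L) i = nth 0%N L
  ((i + k) %% n).
  move=> kn i_n; rewrite /rot nth_cat size_drop sL.
  case: ltnP => ik; first by rewrite nth_drop addnC modn_small //; lia.
  rewrite nth_take; last by lia.
  have -> : (i + k = i - (n - k) + n)%N by lia.
  by rewrite modnDr modn_small //; lia.
split=> [[k]|[t [c2 c3]]].
  wlog kn : k / (k < n)%N => [hw|cE].
    have [/hw//|nk] := ltnP k n; rewrite rot_oversize ?sL // => cE.
    by apply: (hw 0%N); rewrite ?rot0 //; lia.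
  have cx x : c x = nth 0%N L ((x + k) %% n).
    have xn : (x %% n < n)%N by rewrite ltn_mod; lia.
    by rewrite -modnDml -nth_rot ?(ltnW kn) // -cE nth_mkseq // c_mod.
  have cm x j : (x + k = j + n)%N -> (j < n)%N -> c x = if (j.+1 < n)%N then
    2%N else 3%N.
    by move=> e jn; rewrite cx e modnDr modn_small // nthL.
  exists (n - k)%N; split=> [x tx xn|].
    by rewrite (cm x (x + k - n)%N); [case: ifP => //| |]; lia.
  by rewrite (cm _ n.-1); [case: ifP => //| |]; lia.
have tn : (t %% n < n)%N by rewrite ltn_mod; lia.
exists (n - t %% n)%N; apply: (@eq_from_nth _ 0%N);
  rewrite size_mkseq ?size_rot ?sL //.
move=> i i_n; rewrite nth_mkseq // nth_rot ?leq_subr //.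
set j := ((i + _) %% n)%N.
have jn : (j < n)%N by rewrite ltn_mod; lia.
rewrite nthL // -c_mod.
have -> : (i %% n = (t + j) %% n)%N.
  rewrite modnDmr -modnDml addnCA subnKC ?modnDr //; exact: ltnW.
rewrite c_mod; case: ltnP => jn'; first by apply: c2; lia.
by have -> : (t + j = (t + n).-1)%N by lia.
Qed.

Local Close Scope ring_scope.

Theorem corollary5p4 (K : fieldType) (n : nat) (n_gt0 : 0 < n) (A : falgType K)
    (phi : {lrmorphism path_algebra K (cyclic_quiver n_gt0) -> A}) :
  admissible_presentation phi ->
  quasi_hereditary A ->
  (gldim_eq A n <->
     exists k, kupisch_series phi = rot k (rcons (nseq n.-1 2) 3)) /\
  (~ gldim_eq A n -> gldim_le A n.-1).
Proof.
move=> phiP qhA; have [c nakA] := presentation_nakayama phiP.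
have [t ct block] := quasi_hereditary_vertex nakA qhA.
have per := nak_c_per nakA; have mono := nak_c_mono nakA;
  have ge2 := nak_ge2 nakA.
have n2 : (2 <= n)%N := leq_trans (ge2 t) ct.
have gln : gldim_le A n.
  exact: (gldim_stops nakA (stops_all per ge2 mono ct block)).
have rotP := rot_kupisch n2 per; rewrite (kupisch_nakayama nakA).
have special_eq : (exists k, mkseq c n = rot k (rcons (nseq n.-1 2) 3)) ->
    gldim_eq A n.
  move=> /rotP[s [c2 c3]]; split=> // e gle; rewrite leqNgt; apply/negP => en.
  apply: (@gldim_lower _ _ _ _ _ nakA s n2);
    [|by rewrite -subn1 addnBA ?subn1 //; lia|].
    by move=> j jn; apply: c2; lia.
  (* A resolution of length [e < n] also has length at most [n.-1]. *)
  move=> M fgM; have [P [del [eps [h1 h2 h3 h4 h5]]]] := gle M fgM.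
  by exists P, del, eps; split=> // i x ni; apply: h5; lia.
have [st|special] := stops_all_pred per ge2 mono ct block.
  have glp : gldim_le A n.-1 := gldim_stops nakA st.
  split=> //; split=> // [[_ minn]]; have := minn _ glp; lia.
have k_ex : exists k, mkseq c n = rot k (rcons (nseq n.-1 2) 3).
  by apply/rotP; exists t.
by split=> [|ne]; [split=> // _; exact: special_eq|case: ne; exact: special_eq].
Qed.
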